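(* Let $\Omega\subset\mathbb{R}^d$ be open, let $1<p<\infty$, and let $\nu:\mathbb{R}^d\setminus\{0\}\to[0,\infty)$ be measurable and symmetric with $\int_{\mathbb{R}^d}(1\wedge|h|^p)\nu(h)\,dh<\infty$. Assume that $$\omega(x):=\int_\Omega 1\wedge\nu(x-y)\,dy>0\qquad\text{for almost all }x\in\Omega_\nu\setminus\Omega .$$ Then the space $W^p_\nu(\Omega|\mathbb{R}^d)\equiv W^p_\nu(\Omega|\Omega_\nu)$, equipped with $\|\cdot\|_{W^p_\nu(\Omega|\Omega_\nu)}$, is a separable and reflexive Banach space. This conclusion holds in particular when $\nu$ has full support, i.e. $\nu>0$ a.e. on $\mathbb{R}^d$.
   Context: Here $d\ge1$, $a\wedge b=\min(a,b)$, and symmetric means $\nu(h)=\nu(-h)$. The support $\operatorname{supp}\nu$ is the complement of the union of all open sets on which $\nu=0$ a.e. Set $\Omega_\nu=\Omega+\operatorname{supp}\nu$ and $\Omega_\nu^*=\Omega\cup\Omega_\nu$. $W^p_\nu(\Omega|\Omega_\nu)$ is the space of measurable $u:\Omega_\nu^*\to\mathbb{R}$ (modulo a.e. equality on $\Omega_\nu^*$) with $u|_\Omega\in L^p(\Omega)$ and $$|u|^p_{W^p_\nu(\Omega|\Omega_\nu)}=\int_\Omega\int_{\Omega_\nu}|u(x)-u(y)|^p\nu(x-y)\,dy\,dx<\infty,$$ with $\|u\|_{W^p_\nu(\Omega|\Omega_\nu)}=\big(\|u\|^p_{L^p(\Omega)}+|u|^p_{W^p_\nu(\Omega|\Omega_\nu)}\big)^{1/p}$.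 $W^p_\nu(\Omega|\mathbb{R}^d)$ is the space of measurable $u:\mathbb{R}^d\to\mathbb{R}$ with $u|_\Omega\in L^p(\Omega)$ and $\int_\Omega\int_{\mathbb{R}^d}|u(x)-u(y)|^p\nu(x-y)\,dy\,dx<\infty$, with $\|u\|_{W^p_\nu(\Omega|\mathbb{R}^d)}^p=\|u\|^p_{L^p(\Omega)}+\int_\Omega\int_{\mathbb{R}^d}|u(x)-u(y)|^p\nu(x-y)\,dy\,dx$. The two spaces are identified ($\equiv$) isometrically by restriction to $\Omega_\nu^*$ and extension by zero off $\Omega_\nu^*$; in $W^p_\nu(\Omega|\mathbb{R}^d)$ functions that agree a.e. on $\Omega_\nu^*$ are identified. *)

(* Defs.v *)
From HB Require Import structures.
From mathcomp Require Import all_boot all_order all_algebra.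
From mathcomp Require Import all_classical all_reals all_analysis.

Set Implicit Arguments.
Unset Strict Implicit.
Unset Printing Implicit Defensive.

Import Order.TTheory GRing.Theory Num.Theory.
Import numFieldNormedType.Exports.

Local Open Scope classical_set_scope.
Local Open Scope ring_scope.

(** The sigma-algebra generated by the coordinates, as the library does for
    [n.-tuple T]; it is the Borel sigma-algebra of R^n. *)
Section measurable_rV.
Context {R : realType} (n : nat).

Let coors : 'I_n -> 'rV[R]_n -> measurableTypeR R := fun i x => x ord0 i.

Let rV_set0 : g_sigma_preimage coors set0.
Proof. exact: sigma_algebra0. Qed.

Let rV_setC A : g_sigma_preimage coors A -> g_sigma_preimage coors (~` A).
Proof. exact: sigma_algebraC. Qed.

Let rV_bigcup (F : (set 'rV[R]_n)^nat) :
  (forall i, g_sigma_preimage coors (F i)) ->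
  g_sigma_preimage coors (\bigcup_i (F i)).
Proof. exact: sigma_algebra_bigcup. Qed.

HB.instance Definition _ := @isMeasurable.Build default_measure_display
  'rV[R]_n (g_sigma_preimage coors) rV_set0 rV_setC rV_bigcup.

Lemma measurable_rV_coord (i : 'I_n) :
  measurable_fun [set: 'rV[R]_n]
    (fun x : 'rV[R]_n => x ord0 i : measurableTypeR R).
Proof.
move=> _ Y mY; rewrite setTI; apply: sub_sigma_algebra => /=.
rewrite -bigcup_seq/=; exists i => /=; first by rewrite mem_index_enum.
by exists Y => //; rewrite setTI.
Qed.

Lemma measurable_fun_rVP d (T : measurableType d) (f : T -> 'rV[R]_n) :
  (forall i, measurable_fun [set: T]
     (fun x => f x ord0 i : measurableTypeR R)) ->
  measurable_fun [set: T] f.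
Proof.
move=> mf _ A mA; rewrite setTI.
have : preimage_set_system setT f (g_sigma_preimage coors) (f @^-1` A).
  by exists A => //; rewrite setTI.
rewrite -g_sigma_preimage_comp; apply: smallest_sub => [|B].
  exact: sigma_algebra_measurable.
rewrite -bigcup_seq => -[i _] [C mC <-].
by rewrite setTI -[X in measurable X]setTI; exact: mf.
Qed.

End measurable_rV.

Definition rV_cons {R : realType} n (xv : measurableTypeR R * 'rV[R]_n) :
    'rV[R]_n.+1 :=
  row_mx (const_mx xv.1 : 'rV[R]_1) xv.2.

Section rV_cons.
Context {R : realType} (n : nat).

Lemma rV_cons_ord0 xv : @rV_cons R n xv ord0 ord0 = xv.1.
Proof.
rewrite (_ : @ord0 n = lshift n (@ord0 0)); last exact/val_inj.
by rewrite [LHS](@row_mxEl _ 1 1 n) mxE.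
Qed.

Lemma rV_cons_lift xv j : @rV_cons R n xv ord0 (lift ord0 j) = xv.2 ord0 j.
Proof.
rewrite (_ : lift ord0 j = rshift 1 j); last exact/val_inj.
by rewrite [LHS](@row_mxEr _ 1 1 n).
Qed.

Lemma measurable_rV_cons : measurable_fun setT (@rV_cons R n).
Proof.
apply: measurable_fun_rVP => i; have [j ->|->] := unliftP ord0 i; last first.
  rewrite (_ : (fun _ => _) = fst); first exact: measurable_fst.
  by apply/funext => xv; rewrite rV_cons_ord0.
rewrite (_ : (fun _ => _) = (fun v : 'rV[R]_n => v ord0 j : measurableTypeR R)
  \o snd); last by apply/funext => xv; rewrite /= rV_cons_lift.
apply: (measurableT_comp (measurable_rV_coord j)); exact: measurable_snd.
Qed.

Definition rV_uncons (v : 'rV[R]_n.+1) : measurableTypeR R * 'rV[R]_n :=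
  (v ord0 ord0, \row_j v ord0 (lift ord0 j)).

Lemma rV_consK : cancel (@rV_cons R n) rV_uncons.
Proof.
move=> [x v]; rewrite /rV_uncons; congr pair.
  exact: rV_cons_ord0.
by apply/rowP => j; rewrite mxE rV_cons_lift.
Qed.

Lemma measurable_rV_uncons : measurable_fun setT rV_uncons.
Proof.
apply: measurable_fun_pair; first exact: measurable_rV_coord.
apply: measurable_fun_rVP => i; under eq_fun do rewrite mxE.
exact: measurable_rV_coord.
Qed.

Variable m : {sigma_finite_measure set 'rV[R]_n -> \bar R}.

Definition measure_cons : set 'rV[R]_n.+1 -> \bar R :=
  pushforward (lebesgue_measure \x m)%E (@rV_cons R n).

Let measure_cons0 : measure_cons set0 = 0%E.
Proof. by rewrite /measure_cons /pushforward preimage_set0 measure0. Qed.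

Let measurable_preimage_cons (A : set 'rV[R]_n.+1) :
  measurable A -> measurable (@rV_cons R n @^-1` A).
Proof.
by move=> mA; rewrite -[X in measurable X]setTI; exact: measurable_rV_cons.
Qed.

Let measure_cons_ge0 A : (0 <= measure_cons A)%E.
Proof. exact: (measure_ge0 (lebesgue_measure \x m)%E). Qed.

Let measure_cons_sigma_additive : semi_sigma_additive measure_cons.
Proof.
move=> F mF tF mUF; rewrite /measure_cons /pushforward preimage_bigcup.
apply: measure_semi_sigma_additive.
- by move=> k; exact: measurable_preimage_cons.
- apply/trivIsetP => /= i j _ _ ij; rewrite -preimage_setI.
  by move/trivIsetP : tF => /(_ _ _ _ _ ij) ->//; rewrite preimage_set0.
- by rewrite -preimage_bigcup; exact: measurable_preimage_cons.
Qed.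

HB.instance Definition _ := isMeasure.Build _ _ _
  measure_cons measure_cons0 measure_cons_ge0 measure_cons_sigma_additive.

Let measure_cons_sigma_finite : sigma_finite setT measure_cons.
Proof.
have /sigma_finiteP[F [TF ndF Foo]] :=
  sigma_finiteT (@lebesgue_measure R : {sigma_finite_measure set _ -> \bar R}).
have /sigma_finiteP[G [TG ndG Goo]] := sigma_finiteT m.
exists (fun k => rV_uncons @^-1` (F k `*` G k)).
  rewrite -preimage_bigcup; apply/esym/seteqP; split => // v _ /=.
  have [k _ Fk] : (\bigcup_k F k) (rV_uncons v).1 by rewrite -TF.
  have [l _ Gl] : (\bigcup_k G k) (rV_uncons v).2 by rewrite -TG.
  exists (maxn k l) => //; split.
  - by move: Fk; exact/subsetPset/ndF/leq_maxl.
  - by move: Gl; exact/subsetPset/ndG/leq_maxr.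
move=> k; have [mF Fkoo] := Foo k; have [mG Gkoo] := Goo k; split.
  rewrite -[X in measurable X]setTI; apply: measurable_rV_uncons => //.
  exact: measurableX.
rewrite /measure_cons /pushforward -comp_preimage.
rewrite (_ : rV_uncons \o _ = id); last first.
  by apply/funext => x /=; rewrite rV_consK.
by rewrite preimage_id product_measure1E// lte_mul_pinfty// ge0_fin_numE.
Qed.

HB.instance Definition _ := Measure_isSigmaFinite.Build _ _ _
  measure_cons measure_cons_sigma_finite.

End rV_cons.

(** Lebesgue measure on the Borel sets of R^n, as an iterated product. *)
Fixpoint leb {R : realType} (n : nat) :
    {sigma_finite_measure set 'rV[R]_n -> \bar R} :=
  match n with
  | 0 => \d_ (0 : 'rV[R]_0)
  | n'.+1 => measure_cons (leb n')
  end.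

Lemma leb_box {R : realType} (n : nat) (A : 'I_n -> set (measurableTypeR R)) :
  (forall i, measurable (A i)) ->
  leb n [set v | forall i, A i (v ord0 i)] =
  (\prod_(i < n) lebesgue_measure (A i))%E.
Proof.
elim: n A => [|n ih] A mA.
  rewrite big_ord0 /= /dirac indicE mem_set//.
  by case.
rewrite big_ord_recl -ih//= /measure_cons /pushforward.
have mB : measurable [set v : 'rV[R]_n | forall i, A (lift ord0 i) (v ord0 i)].
  rewrite (_ : mkset _ = \bigcap_(i in [set: 'I_n])
      ((fun v : 'rV[R]_n => v ord0 i : measurableTypeR R) @^-1`
        A (lift ord0 i))).
    apply: fin_bigcap_measurable => //= i _.
    by rewrite -[X in measurable X]setTI; apply: measurable_rV_coord.
  by apply/seteqP; split => v /= h i; [move=> _|]; exact: h.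
rewrite -product_measure1E//=.
congr (_ _); apply/seteqP; split => -[x v] /=.
  move=> h; split => [|i].
    by have := h ord0; rewrite rV_cons_ord0.
  by have := h (lift ord0 i); rewrite rV_cons_lift.
move=> [hx hv] i; have [j ->|->] := unliftP ord0 i; last first.
  by rewrite rV_cons_ord0.
by rewrite rV_cons_lift.
Qed.

Definition separable_space (T : topologicalType) : Prop :=
  exists2 A : set T, countable A & dense A.

Section dual.
Context {R : realType} (V : normedModType R).

Definition in_dual (phi : V -> R) : Prop :=
  linear (phi : V -> R^o) /\ continuous phi.

Definition dual_norm (phi : V -> R) : R :=
  sup [set `|phi x| | x in [set x : V | `|x| <= 1]].

(** Elements of the bidual are given by their values on the continuous linear
    functionals; the values of [Phi] elsewhere are irrelevant. *)
Definition in_bidual (Phi : (V -> R) -> R) : Prop :=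
  (forall (a : R) phi psi, in_dual phi -> in_dual psi ->
     Phi (fun x => a * phi x + psi x) = a * Phi phi + Phi psi) /\
  (exists C : R, forall phi, in_dual phi -> `|Phi phi| <= C * dual_norm phi).

Definition reflexive_space : Prop :=
  forall Phi, in_bidual Phi ->
    exists x : V, forall phi, in_dual phi -> Phi phi = phi x.

End dual.

Section nonlocal_sobolev.
Context {R : realType} (d : nat).
Notation E := 'rV[R]_d.
Implicit Types (Omega : set E) (nu : E -> R) (p : R) (u v : E -> R).

(** The library norm on ['rV[R]_d] is the max norm. *)
Definition euclidean_norm (h : E) : R := Num.sqrt (\sum_i h ord0 i ^+ 2).

Definition supp nu : set E :=
  ~` \bigcup_(O in [set O : set E |
       open O /\ {ae leb d, forall h, O h -> nu h = 0}]) O.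

Definition Omega_nu Omega nu : set E :=
  [set x + h | x in Omega & h in supp nu].

Definition Omega_nu_star Omega nu : set E := Omega `|` Omega_nu Omega nu.

Local Open Scope ereal_scope.

Definition omega Omega nu (x : E) : \bar R :=
  \int[leb d]_(y in Omega) (Num.min 1%R (nu (x - y)%R))%:E.

Definition Lp_pow Omega p u : \bar R :=
  \int[leb d]_(x in Omega) (`|u x| `^ p)%:E.

Definition seminorm_pow Omega (D : set E) nu p u : \bar R :=
  \int[leb d]_(x in Omega) \int[leb d]_(y in D)
    (`|u x - u y| `^ p * nu (x - y)%R)%:E.

Definition W_norm Omega D nu p u : \bar R :=
  (Lp_pow Omega p u + seminorm_pow Omega D nu p u) `^ p^-1.

(** Representatives of the elements of W^p_nu(Omega|Omega_nu). A function on
    Omega_nu^* is a total function of which only the values on Omega_nu^*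
    matter. *)
Definition W_Omega_nu Omega nu p : set (E -> R) :=
  [set u | [/\ measurable_fun (Omega_nu_star Omega nu) u,
               Lp_pow Omega p u < +oo &
               seminorm_pow Omega (Omega_nu Omega nu) nu p u < +oo]].

(** Representatives of the elements of W^p_nu(Omega|R^d). *)
Definition W_Rd Omega nu p : set (E -> R) :=
  [set u | [/\ measurable_fun [set: E] u,
               Lp_pow Omega p u < +oo &
               seminorm_pow Omega [set: E] nu p u < +oo]].

Definition ae_eq_star Omega nu u v : Prop :=
  {ae leb d, forall x, Omega_nu_star Omega nu x -> u x = v x}.

Local Close Scope ereal_scope.

(** [cls] exhibits [B] as the normed space obtained from the vector space [W]
    of functions by identifying functions related by [eqv], equipped with the
    norm induced by [N]: [cls u] is the class of [u]. *)
Definition is_quotient_space (B : normedModType R) (W : set (E -> R))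
    (eqv : (E -> R) -> (E -> R) -> Prop) (N : (E -> R) -> \bar R)
    (cls : (E -> R) -> B) : Prop :=
  [/\ forall a u v, W u -> W v ->
        W (a *: u + v) /\ cls (a *: u + v) = a *: cls u + cls v,
      forall b, exists2 u, W u & cls u = b,
      forall u v, W u -> W v -> (cls u = cls v <-> eqv u v) &
      forall u, W u -> `|cls u|%:E = N u].

(** W^p_nu(Omega|R^d) and W^p_nu(Omega|Omega_nu) are one and the same Banach
    space [B]: as [cls] is common to both, restricting to Omega_nu^* is
    inclusion of representatives, and its inverse is extension by zero. *)
Definition W_separable_reflexive_Banach Omega nu p : Prop :=
  exists (B : completeNormedModType R) (cls : (E -> R) -> B),
    [/\ is_quotient_space (W_Omega_nu Omega nu p) (ae_eq_star Omega nu)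
          (W_norm Omega (Omega_nu Omega nu) nu p) cls,
        is_quotient_space (W_Rd Omega nu p) (ae_eq_star Omega nu)
          (W_norm Omega [set: E] nu p) cls,
        (W_Rd Omega nu p `<=` W_Omega_nu Omega nu p) /\
        (forall u, W_Omega_nu Omega nu p u ->
           W_Rd Omega nu p (patch (cst 0) (Omega_nu_star Omega nu) u)),
        separable_space B &
        reflexive_space B].

End nonlocal_sobolev.

(* Main.v *)
Require Import Defs.
From HB Require Import structures.
From mathcomp Require Import all_boot all_order all_algebra ring lra.
From mathcomp Require Import all_classical all_reals all_analysis.
From mathcomp Require Import measurable_realfun.

(** The argument is the direct method: the space is realised as a normed
quotient, its norm is shown to be uniformly convex, and uniform convexity
alone then gives reflexivity and, with a countable separating family of
functionals, separability.

For functions u on the star set, put E(u) = int_Omega |u|^p plus the double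
integral over Omega x Omega_nu of |u(x) - u(y)|^p nu(x - y). Every property of
E that matters comes from integrating an inequality between p-th powers of
linear combinations of two real numbers ([energy_ineq]): convexity and
homogeneity, which make E^(1/p) a seminorm, and a uniform convexity estimate
whose pointwise form is [abs_powR_uniformly_convex]. Besides these, E is lower
semicontinuous under almost everywhere convergence, by Fatou's lemma
([energy_fatou]).

The hypothesis on omega enters once. If omega >= c on a set B of finite
measure inside Omega_nu, then c int_B |u|^p is at most the double integral of
|u(y)|^p min(1, nu(x - y)), and |u(y)|^p <= 2^p (|u(x)|^p + |u(x) - u(y)|^p)
bounds this by a multiple of E(u) ([energy_controls_power]). As omega > 0 almost
everywhere on Omega_nu outside Omega, the star set is, up to a null set, a
countable union of sets of finite measure on each of which E controls the L^p
norm ([energy_exhaustion]). So E(u) = 0 forces u = 0 almost everywhere; a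
Cauchy sequence has a subsequence converging almost everywhere, whose limit is
a limit for E by Fatou ([modular_complete]); and the integrals of u over the
pieces of this union, cut along rational boxes, are bounded functionals that
separate points ([modular_quotient_separable]).

On the Banach space side everything rests on one compactness statement
([directed_near_minimal]): in a uniformly convex Banach space a downward
directed family of closed convex sets that all meet a fixed ball has a common
point, and almost minimal elements of the small sets are close to it. For
reflexivity, given a bounded functional Phi on the dual, the sets where finitely
many phi_i are within e of Phi(phi_i) form such a family; they meet the ball
whose radius is the bound of Phi because minimising
|x| + k sum (phi_i(x) - Phi(phi_i))^2 produces a combination of the phi_i that
is a subgradient of the norm ([helly_approx]). For separability, the sets are
cut out by rational bounds on the separating functionals, and almost minimal
elements of all of them form a countable dense set.

Finally the two descriptions of the space agree because nu vanishes almost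
everywhere off its support, so that integrating y over the whole space or over
Omega_nu gives the same energy; this uses the invariance of Lebesgue measure
under y |-> x - y ([leb_reflection], [seminorm_pow_setT]). *)

Set Implicit Arguments.
Unset Strict Implicit.
Unset Printing Implicit Defensive.

Import Order.TTheory GRing.Theory Num.Theory.
Import numFieldNormedType.Exports.

Local Open Scope classical_set_scope.
Local Open Scope ring_scope.

(** * Uniformly convex Banach spaces *)

Section powR_mono.
Context {R : realType} (p : R) (p0 : 0 < p).

Lemma powR_homo_le (a b : R) : 0 <= a -> a <= b -> a `^ p <= b `^ p.
Proof.
move=> a0 ab; apply: ge0_ler_powR => //; first exact: ltW.
by rewrite nnegrE (le_trans a0).
Qed.

Lemma powR_lt_cancel (a b : R) : 0 <= b -> a `^ p < b `^ p -> a < b.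
Proof. by move=> b0; rewrite !ltNge; apply: contra; exact: powR_homo_le. Qed.

End powR_mono.

(** For closed sets this amounts to convexity. *)
Definition midpoint_closed {R : realType} {V : lmodType R} (K : set V) :=
  forall x y, K x -> K y -> K (2^-1 *: (x + y)).

(** Uniform convexity written for p-th powers of the norm, so that it follows from
the corresponding inequality between real numbers by integration. *)
Definition power_uniformly_convex {R : realType} (V : normedModType R) (p : R) :=
  forall e : R, 0 < e -> exists2 C : R, 0 <= C & forall x y : V,
    `|x - y| `^ p + C * `|2^-1 *: (x + y)| `^ p <=
    (e + C / 2) * (`|x| `^ p + `|y| `^ p).

Section least_power.
Context {R : realType} (V : normedModType R) (p : R).

Definition least_power (A : set V) : R := inf [set `|x| `^ p | x in A].

Let lb_least (A : set V) : has_lbound [set `|x| `^ p | x in A].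
Proof. by exists 0 => _ [x _ <-]; exact: powR_ge0. Qed.

Lemma least_power_le (A : set V) x : A x -> least_power A <= `|x| `^ p.
Proof. by move=> Ax; apply: ge_inf => //; exists x. Qed.

Lemma least_power_adherent (A : set V) (e : R) : 0 < e -> A !=set0 ->
  exists2 x, A x & `|x| `^ p < least_power A + e.
Proof.
move=> e0 [a Aa].
have [|_ [x Ax <-] ?] := @inf_adherent _ [set `|x| `^ p | x in A] e e0.
  by split => //; exists (`|a| `^ p), a.
by exists x.
Qed.

End least_power.

Section directed_families.
Context {R : realType} (V : completeNormedModType R) (p : R).
Hypotheses (p0 : 0 < p) (ucV : power_uniformly_convex V p).
Context {I : Type} (D : set I) (K : I -> set V) (M : R).
Hypotheses (D_nonempty : D !=set0)
  (K_closed : forall i, D i -> closed (K i))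
  (K_mid : forall i, D i -> midpoint_closed (K i))
  (K_dir : forall i j, D i -> D j ->
     exists2 k, D k & K k `<=` K i `&` K j)
  (K_bnd : forall i, D i -> exists2 x, K i x & `|x| <= M).

Let s : R := sup [set least_power p (K i) | i in D].

Let M_ge0 : 0 <= M.
Proof.
have [i Di] := D_nonempty; have [x _ xM] := K_bnd Di.
exact: (le_trans (normr_ge0 x) xM).
Qed.

Let sE : has_sup [set least_power p (K i) | i in D].
Proof.
split; first by have [i Di] := D_nonempty; exists (least_power p (K i)), i.
exists (M `^ p) => _ [i Di <-]; have [x Kx xM] := K_bnd Di.
by apply: le_trans (least_power_le p Kx) _; exact: powR_homo_le.
Qed.

Let le_s i : D i -> least_power p (K i) <= s.
Proof. by move=> Di; apply: ub_le_sup; [case: sE|exists i]. Qed.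

Let s_ge0 : 0 <= s.
Proof.
have [i Di] := D_nonempty; apply: le_trans (le_s Di).
have [x Kx _] := K_bnd Di.
by apply: lb_le_inf; [exists (`|x| `^ p), x|move=> _ [y _ <-]; exact: powR_ge0].
Qed.

Let slice i (n : R) := K i `&` [set x | `|x| `^ p <= s + n].

Let slice_small (e : R) : 0 < e -> exists i (n : R), [/\ D i, 0 < n &
  forall x y, slice i n x -> slice i n y -> `|x - y| < e].
Proof.
move=> e0; have ep0 : 0 < e `^ p by exact: powR_gt0.
pose e1 := e `^ p / (4 * (s + 1)).
have s1 : 0 < s + 1 by have := s_ge0; lra.
have e10 : 0 < e1 by rewrite divr_gt0// mulr_gt0.
have [C C0 HC] := ucV e10.
pose n := Num.min 1 (e `^ p / (8 * (C + 1))).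
have C1 : 0 < C + 1 by lra.
have n0 : 0 < n by rewrite lt_min ltr01 divr_gt0// mulr_gt0.
have n1 : n <= 1 by rewrite ge_min lexx.
have nC : n * (8 * (C + 1)) <= e `^ p.
  by rewrite -ler_pdivlMr ?mulr_gt0// ge_min lexx orbT.
have e1E : e1 * (4 * (s + 1)) = e `^ p by rewrite divfK// gt_eqF// mulr_gt0.
have [_ [i Di <-] si] := sup_adherent n0 sE.
exists i, n; split=> // x y [Kx xs] [Ky ys].
apply: (powR_lt_cancel p0 (ltW e0)).
have := HC x y; have := least_power_le p (K_mid Di Kx Ky).
set m := `|2^-1 *: _| `^ p; set q := `|x - y| `^ p => mlow H.
have sm : s - n <= m by rewrite (le_trans _ mlow)// ltW.
rewrite /= in xs ys.
have H1 : (e1 + C / 2) * (`|x| `^ p + `|y| `^ p) <= (e1 + C / 2) * (2 * (s + n)).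
  by apply: ler_wpM2l; [apply: addr_ge0; [exact: ltW|exact: divr_ge0]|lra].
have H2 : C * (s - n) <= C * m by exact: ler_wpM2l.
have H3 : e1 * (s + n) <= e1 * (s + 1) by rewrite ler_pM2l// lerD2l.
lra.
Qed.

Let slice_nonempty i (n : R) : D i -> 0 < n -> slice i n !=set0.
Proof.
move=> Di n0; have [x Kx _] := K_bnd Di.
have [y Ky yn] := least_power_adherent p n0 (ex_intro _ x Kx).
exists y; split => //=; have := le_s Di; lra.
Qed.

(** The sets K i cut by the sublevels of the norm just above the supremum s of the
least powers form a Cauchy filter: two points of such a slice have their
midpoint in K i, whose norm is almost maximal among the least powers, and
uniform convexity makes them close. The common point is its limit. As no
least power exceeds s, almost minimal elements of any smaller K j lie in
the same slice. *)
Lemma directed_near_minimal : exists2 x, (forall i, D i -> K i x) &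
  forall e : R, 0 < e -> exists i n, [/\ D i, 0 < n &
    forall j y, D j -> K j `<=` K i -> K j y ->
      `|y| `^ p <= least_power p (K j) + n -> `|x - y| < e].
Proof.
pose B : set (I * R) := [set u | D u.1 /\ 0 < u.2].
pose F := filter_from B (fun u => slice u.1 u.2).
have FF : ProperFilter F.
  apply: filter_from_proper; last first.
    by move=> [i n] [Di n0]; exact: slice_nonempty.
  apply: filter_from_filter.
    by have [i Di] := D_nonempty; exists (i, 1); split.
  move=> [i n] [j m] [Di n0] [Dj m0].
  have [k Dk Kk] := K_dir Di Dj.
  exists (k, Num.min n m); first by split => //; rewrite lt_min n0.
  move=> x [Kx /= xs]; have [Ki Kj] := Kk _ Kx.
  by split; split => //=; apply: le_trans xs _; rewrite lerD2l ge_min lexx ?orbT.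
have Fc : cvg F.
  apply/cauchy_cvgP; apply: cauchy_exP => e e0.
  have [i [n [Di n0 H]]] := slice_small e0.
  have [x xs] := slice_nonempty Di n0.
  exists x; exists (i, n) => //= y ys.
  by rewrite -ball_normE /=; exact: H.
exists (lim F).
  move=> i Di; apply: (@closed_cvg _ _ F _ id (K i) (K_closed Di)) => //.
  by exists (i, 1) => // x [].
move=> e e0; have e20 : 0 < e / 2 by rewrite divr_gt0.
have [i [n [Di n0 H]]] := slice_small e20.
exists i, n; split => // j y Dj ji Kjy ym.
have ys : slice i n y.
  split; first exact: ji.
  by rewrite /= (le_trans ym)// lerD2r le_s.
have : F (ball (lim F) (e / 2)) by apply: Fc; exact: nbhsx_ballx.
move=> Fb; have Fs : F (slice i n) by exists (i, n).
have [z [bz sz]] := filter_ex (filterI Fb Fs).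
rewrite -ball_normE /= in bz.
have zy := H _ _ sz ys; rewrite [e]splitr.
by rewrite (le_lt_trans (ler_distD z _ _))// ltrD.
Qed.

End directed_families.

Section dual_basics.
Context {R : realType} (V : normedModType R).
Implicit Types phi : V -> R.

Lemma in_dualD phi x y : in_dual phi -> phi (x + y) = phi x + phi y.
Proof. by move=> [l _]; have := l 1 x y; rewrite !scale1r. Qed.

Lemma in_dual0 phi : in_dual phi -> phi 0 = 0.
Proof.
by move=> pd; have := in_dualD 0 0 pd; rewrite addr0; lra.
Qed.

Lemma in_dualZ phi a x : in_dual phi -> phi (a *: x) = a * phi x.
Proof.
by move=> pd; have [l _] := pd; have := l a x 0; rewrite !addr0 in_dual0// addr0.
Qed.

Lemma in_dualB phi x y : in_dual phi -> phi (x - y) = phi x - phi y.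
Proof. by move=> pd; rewrite in_dualD// -scaleN1r in_dualZ// mulN1r. Qed.

Lemma in_dual_comb a phi psi : in_dual phi -> in_dual psi ->
  in_dual (fun x => a * phi x + psi x).
Proof.
move=> pd sd; split.
  move=> b x y /=; rewrite !in_dualD// !in_dualZ//.
  by rewrite /GRing.scale/=; ring.
move=> x; apply: cvgD; last by case: sd => _; exact.
by apply: cvgM; [exact: cvg_cst|case: pd => _; exact].
Qed.

Lemma in_dual_zero : in_dual (fun _ : V => 0 : R).
Proof.
split; first by move=> a x y; rewrite /GRing.scale/= mulr0 addr0.
by move=> x; exact: cvg_cst.
Qed.

Lemma in_dual_bounded phi (M : R) : linear (phi : V -> R^o) -> 0 <= M ->
  (forall x, `|phi x| <= M * `|x|) -> in_dual phi.
Proof.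
move=> l M0 bM; split => // x; apply/cvgrPdist_lt => e e0.
have M1 : 0 < M + 1 by rewrite ltr_wpDl.
have d0 : 0 < e / (M + 1) by rewrite divr_gt0.
apply: filterS (nbhsx_ballx x _ d0) => y; rewrite -ball_normE /= => xy.
have -> : phi x - phi y = phi (x - y).
  have := l (-1) y x; rewrite scaleN1r (addrC (- y)) => ->.
  by rewrite /GRing.scale/=; ring.
apply: le_lt_trans (bM _) _; rewrite ltr_pdivlMr// in xy.
by apply: le_lt_trans xy; rewrite mulrC ler_wpM2l// lerDl.
Qed.

Lemma in_dual_sum (l : seq (V -> R)) (c : (V -> R) -> R) :
  (forall phi, phi \in l -> in_dual phi) ->
  in_dual (fun x => \sum_(phi <- l) c phi * phi x).
Proof.
elim: l => [|phi l ih] H.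
  under eq_fun do rewrite big_nil; exact: in_dual_zero.
under eq_fun do rewrite big_cons; apply: in_dual_comb.
  by apply: H; rewrite mem_head.
by apply: ih => psi pl; apply: H; rewrite in_cons pl orbT.
Qed.

Lemma bidual_sum Phi (l : seq (V -> R)) (c : (V -> R) -> R) : in_bidual Phi ->
  (forall phi, phi \in l -> in_dual phi) ->
  Phi (fun x => \sum_(phi <- l) c phi * phi x) = \sum_(phi <- l) c phi * Phi phi.
Proof.
move=> [L _]; elim: l => [|phi l ih] H.
  rewrite big_nil; under eq_fun do rewrite big_nil.
  have := L 1 _ _ in_dual_zero in_dual_zero.
  under eq_fun do rewrite mulr0 addr0.
  by rewrite mul1r; lra.
rewrite big_cons; under eq_fun do rewrite big_cons.
have H' psi : psi \in l -> in_dual psi.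
  by move=> pl; apply: H; rewrite in_cons pl orbT.
rewrite L ?ih//; first by apply: H; rewrite mem_head.
exact: in_dual_sum.
Qed.

Lemma dual_norm_le1 (psi : V -> R) : in_dual psi -> (forall y, psi y <= `|y|) ->
  0 <= dual_norm psi <= 1.
Proof.
move=> pd H.
have H2 y : `|psi y| <= `|y|.
  rewrite ler_norml H andbT lerNl.
  by have := H (- y); rewrite normrN -scaleN1r in_dualZ// mulN1r.
have ne : [set `|psi x| | x in [set x : V | `|x| <= 1]] !=set0.
  by exists `|psi 0|, 0 => //=; rewrite normr0.
have ub : ubound [set `|psi x| | x in [set x : V | `|x| <= 1]] 1.
  by move=> _ [x /= x1 <-]; exact: le_trans x1.
apply/andP; split; last exact: ge_sup.
apply: le_trans (normr_ge0 (psi 0)) _; apply: ub_le_sup; first by exists 1.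
by exists 0 => //=; rewrite normr0.
Qed.

End dual_basics.

Section milman_pettis.
Context {R : realType} (V : completeNormedModType R) (p : R).
Hypotheses (p0 : 0 < p) (ucV : power_uniformly_convex V p).

(** The sublevel sets above the infimum are closed, convex and bounded, so they have
a common point by [directed_near_minimal]. *)
Lemma norm_penalty_minimizer (Q : V -> R) : continuous Q ->
  (forall x, 0 <= Q x) ->
  (forall x y, Q (2^-1 *: (x + y)) <= 2^-1 * (Q x + Q y)) ->
  exists x, forall y, `|x| + Q x <= `|y| + Q y.
Proof.
move=> cQ Q0 Qmid.
pose G y := `|y| + Q y.
have hG : has_inf (range G).
  split; first by exists (G 0), 0.
  by exists 0 => _ [y _ <-]; rewrite addr_ge0.
pose m := inf (range G).
pose K (n : R) := [set y | G y <= m + n].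
have cG : continuous G.
  by move=> y; apply: cvgD; [exact: norm_continuous|exact: cQ].
have [|||||x Hx _] := @directed_near_minimal R V p p0 ucV R [set n | 0 < n] K
    (m + 1).
- by exists 1; rewrite /= ltr01.
- move=> n _; rewrite (_ : K n = G @^-1` [set t | t <= m + n])//.
  by apply: closed_comp; [move=> y _; exact: cG|exact: closed_le].
- move=> n _ x y; rewrite /K /= => Gx Gy; rewrite /G.
  have := Qmid x y; have := ler_normD x y.
  by rewrite normrZ ger0_norm// /G in Gx Gy *; lra.
- move=> a b a0 b0; exists (Num.min a b); first by rewrite /= lt_min a0.
  by move=> y /= Gy; split; apply: le_trans Gy _; rewrite lerD2l ge_min lexx ?orbT.
- move=> n n0; have n10 : 0 < Num.min 1 n by rewrite lt_min ltr01.
  have [_ [y _ <-] yn] := inf_adherent n10 hG.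
  exists y; rewrite /K/=.
    by apply: le_trans (ltW yn) _; rewrite lerD2l ge_min lexx orbT.
  apply: (@le_trans _ _ (G y)); first by rewrite /G lerDl.
  by apply: le_trans (ltW yn) _; rewrite lerD2l ge_min lexx.
exists x => y; apply: (@le_trans _ _ m); last first.
  by apply: ge_inf; [case: hG|exists y].
by apply/ler_addgt0Pr => e e0; exact: Hx.
Qed.

(** Helly's theorem, up to e, without the Hahn-Banach theorem. At a minimiser x of
|y| + k sum (Phi phi - phi y)^2 the derivative psi of the penalty, up to sign,
is a subgradient of the norm: psi x = |x| and psi <= |.|. As psi is a
combination of the phi, Phi psi = |x| + 2 Q x, and Phi psi <= C bounds both
terms; a large k then makes the residuals small. *)
Lemma helly_approx (Phi : (V -> R) -> R) (C : R) (l : seq (V -> R)) (e : R) :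
  in_bidual Phi -> 0 <= C ->
  (forall phi, in_dual phi -> `|Phi phi| <= C * dual_norm phi) ->
  (forall phi, phi \in l -> in_dual phi) -> 0 < e ->
  exists2 x, `|x| <= C & forall phi, phi \in l -> `|phi x - Phi phi| <= e.
Proof.
move=> bPhi C0 HC ld e0.
(* k e^2 > C, so a residual larger than e would make the penalty exceed C *)
pose k := C / e ^+ 2 + 1.
have k0 : 0 < k by rewrite ltr_pwDr// divr_ge0// exprn_ge0// ltW.
pose Q y := \sum_(phi <- l) k * (Phi phi - phi y) ^+ 2.
have cQ : continuous Q.
  rewrite /Q; elim: l ld {Q} => [|phi l ih] ld x.
    by under eq_fun do rewrite big_nil; exact: cvg_cst.
  under eq_fun do rewrite big_cons; apply: cvgD; last first.
    by apply: ih => psi pl; apply: ld; rewrite in_cons pl orbT.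
  apply: cvgM; first exact: cvg_cst.
  have cp : {for x, continuous (fun y => Phi phi - phi y)}.
    apply: cvgB; first exact: cvg_cst.
    by have [] := ld phi (mem_head _ _) => _; exact.
  by under eq_fun do rewrite expr2; exact: cvgM.
have Q0 y : 0 <= Q y by apply: sumr_ge0 => phi _; rewrite mulr_ge0 ?sqr_ge0// ltW.
have Qt x v t : Q (x + t *: v) =
    Q x - t * (\sum_(phi <- l) (2 * k * (Phi phi - phi x)) * phi v)
    + t ^+ 2 * \sum_(phi <- l) k * phi v ^+ 2.
  rewrite /Q !mulr_sumr -sumrB -big_split/=; apply: eq_big_seq => phi pl.
  by rewrite (in_dualD _ _ (ld _ pl)) (in_dualZ _ _ (ld _ pl)); ring.
have Qmid x y : Q (2^-1 *: (x + y)) <= 2^-1 * (Q x + Q y).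
  rewrite /Q -big_split/= mulr_sumr !big_seq; apply: ler_sum => phi pl.
  rewrite (in_dualZ _ _ (ld _ pl)) (in_dualD _ _ (ld _ pl)).
  have := mulr_ge0 (ltW k0) (sqr_ge0 (phi x - phi y)).
  by nra.
have [x xmin] := norm_penalty_minimizer cQ Q0 Qmid.
pose psi v := \sum_(phi <- l) (2 * k * (Phi phi - phi x)) * phi v.
have dpsi : in_dual psi := in_dual_sum _ ld.
(* The first-order condition at x along the segment to y, using only the
   convexity of the norm; t is small enough for the quadratic term B. *)
have sub y : psi (y - x) <= `|y| - `|x|.
  set B := \sum_(phi <- l) k * phi (y - x) ^+ 2.
  have B0 : 0 <= B by apply: sumr_ge0 => phi _; rewrite mulr_ge0 ?sqr_ge0// ltW.
  apply/ler_addgt0Pr => d d0.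
  pose t := Num.min 1 (d / (B + 1)).
  have B1 : 0 < B + 1 by lra.
  have t0 : 0 < t by rewrite lt_min ltr01 divr_gt0.
  have t1 : t <= 1 by rewrite ge_min lexx.
  have td : t * (B + 1) <= d by rewrite -ler_pdivlMr// ge_min lexx orbT.
  have := xmin (x + t *: (y - x)); rewrite Qt -/(psi _) -/B => H.
  have H2 : `|x + t *: (y - x)| <= (1 - t) * `|x| + t * `|y|.
    rewrite (_ : x + _ = (1 - t) *: x + t *: y); last first.
      by rewrite scalerBr scalerBl scale1r; rewrite addrAC addrA.
    apply: le_trans (ler_normD _ _) _.
    by rewrite !normrZ (ger0_norm (ltW t0)) ger0_norm// subr_ge0.
  have H3 : t * psi (y - x) <= t * (`|y| - `|x| + t * B) by lra.
  rewrite ler_pM2l// in H3; apply: le_trans H3 _.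
  by rewrite lerD2l; lra.
have psix : psi x = `|x|.
  have := sub 0; have := sub (2 *: x).
  rewrite normrZ ger0_norm// normr0 !(in_dualB _ _ dpsi) (in_dualZ _ _ dpsi).
  by rewrite (in_dual0 dpsi); lra.
have psi1 y : psi y <= `|y| by have := sub y; rewrite (in_dualB _ _ dpsi) psix; lra.
have /andP[n0 n1] := dual_norm_le1 dpsi psi1.
have PhiE : Phi psi = `|x| + 2 * Q x.
  rewrite -psix /psi bidual_sum// /Q mulr_sumr -big_split/=.
  by apply: eq_bigr => phi _; ring.
have xQ : `|x| + 2 * Q x <= C.
  rewrite -PhiE; apply: le_trans (ler_norm _) _; apply: le_trans (HC _ dpsi) _.
  by rewrite ler_piMr.
exists x; first by have := Q0 x; lra.
move=> phi pl; rewrite distrC.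
have : k * (Phi phi - phi x) ^+ 2 <= C.
  apply: (@le_trans _ _ (Q x)); last by have := normr_ge0 x; have := Q0 x; lra.
  rewrite /Q (big_rem phi)//= lerDl.
  by apply: sumr_ge0 => ? _; rewrite mulr_ge0 ?sqr_ge0// ltW.
rewrite -(real_normK (num_real (Phi phi - phi x))) => H.
rewrite leNgt; apply/negP => ee.
have : C < C.
  apply: lt_le_trans H.
  have e2 : 0 < e ^+ 2 by exact: exprn_gt0.
  have : e ^+ 2 <= `|Phi phi - phi x| ^+ 2.
    by rewrite lerXn2r// ?nnegrE ltW.
  move=> H; apply: (@lt_le_trans _ _ (k * e ^+ 2)); last by rewrite ler_pM2l.
  by rewrite /k mulrDl mul1r divfK ?gt_eqF// ltrDl.
by rewrite ltxx.
Qed.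

(** The Milman-Pettis theorem: the sets of approximate solutions of phi x = Phi phi,
for finitely many phi and a tolerance, are directed and meet a fixed ball by
[helly_approx]; a common point solves all the equations. *)
Theorem uniformly_convex_reflexive : reflexive_space V.
Proof.
move=> Phi bPhi; have [_ [C0 HC0]] := bPhi.
pose C := Num.max C0 0.
have C_ge0 : 0 <= C by rewrite le_max lexx orbT.
have HC phi : in_dual phi -> `|Phi phi| <= C * dual_norm phi.
  move=> pd; apply: le_trans (HC0 _ pd) _.
  have [n0|n0] := leP 0 (dual_norm phi).
    by rewrite ler_wpM2r// le_max lexx.
  exfalso; move: n0; rewrite ltNge => /negP; apply.
  have [hs|hs] := pselect (has_sup [set `|phi x| | x in [set x : V | `|x| <= 1]]).
    apply: (@le_trans _ _ `|phi 0|) => //; apply: ub_le_sup; first by case: hs.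
    by exists 0 => //=; rewrite normr0.
  by rewrite /dual_norm sup_out.
pose D : set (seq (V -> R) * R) :=
  [set i : seq (V -> R) * R | (forall phi, phi \in i.1 -> in_dual phi) /\ 0 < i.2].
pose K (i : seq (V -> R) * R) :=
  [set x | forall phi, phi \in i.1 -> `|phi x - Phi phi| <= i.2].
have [|||||x Hx _] := @directed_near_minimal R V p p0 ucV _ D K C.
- by exists ([::], 1); split.
- move=> [l e] [/= ld e0].
  rewrite (_ : K _ = \bigcap_(phi in [set phi | phi \in l])
      ((fun x => `|phi x - Phi phi|) @^-1` [set t | t <= e]))//.
  apply: closed_bigI => phi pl; apply: closed_comp; last exact: closed_le.
  move=> x _; apply: cvg_norm; apply: cvgB; last exact: cvg_cst.
  by have [_] := ld phi pl; exact.
- move=> [l e] [/= ld e0] x y Kx Ky phi pl.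
  rewrite (in_dualZ _ _ (ld _ pl)) (in_dualD _ _ (ld _ pl)).
  have := Kx phi pl; have := Ky phi pl; rewrite /= !ler_norml => /andP[? ?] /andP[? ?].
  by apply/andP; split; lra.
- move=> [l e] [l' e'] [/= ld e0] [/= ld' e0'].
  exists (l ++ l', Num.min e e').
    split => /=; last by rewrite lt_min e0.
    by move=> phi; rewrite mem_cat => /orP[/ld|/ld'].
  by move=> x Kx; split=> phi pl; (apply: le_trans (Kx phi _) _ => /=;
    [by rewrite mem_cat pl ?orbT|by rewrite ge_min lexx ?orbT]).
- move=> [l e] [/= ld e0].
  by have [x xC xK] := helly_approx bPhi C_ge0 HC ld e0; exists x.
exists x => phi pd; apply/esym/eqP; rewrite -subr_eq0 -normr_le0.
apply/ler_addgt0Pr => e e0; rewrite add0r.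
by apply: (Hx ([:: phi], e)); [split => //= psi|]; rewrite inE// => /eqP ->.
Qed.

(** A point x0 is the only common point of the sets cut out by rational bounds that
hold at x0, so it is the limit of almost minimal elements of these sets, and
there are only countably many such sets altogether. *)
Theorem uniformly_convex_separable (phi : nat -> V -> R) :
  (forall k, in_dual (phi k)) ->
  (forall x y, (forall k, phi k x = phi k y) -> x = y) ->
  separable_space V.
Proof.
move=> pd tot.
pose K (l : seq (nat * rat * rat)) : set V := [set y | forall u, u \in l ->
  ratr u.1.2 <= phi u.1.1 y <= ratr u.2].
have adh l n : exists y, K l !=set0 -> K l y /\
    `|y| `^ p <= least_power p (K l) + n.+1%:R^-1.
  have [ne|ne] := pselect (K l !=set0); last by exists 0 => /ne.
  have [|y Ky yl] := @least_power_adherent _ _ p (K l) n.+1%:R^-1 _ ne.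
    by rewrite invr_gt0.
  by exists y => _; split => //; exact: ltW.
pose pt (u : seq (nat * rat * rat) * nat) := sval (cid (adh u.1 u.2)).
exists (range pt); first by apply: sub_countable (card_image_le _ _) _; exact: countableP.
move=> O [x0 Ox0] oO.
pose D := [set l | K l x0].
have [|||||x Hx near_x] := @directed_near_minimal R V p p0 ucV _ D K `|x0|.
- by exists [::].
- move=> l _; rewrite (_ : K l = \bigcap_(u in [set u | u \in l])
      (phi u.1.1 @^-1` `[ratr u.1.2, ratr u.2]%classic)); last first.
    by apply/seteqP; split => y Ky u ul; have := Ky u ul; rewrite /= in_itv/=.
  apply: closed_bigI => u ul; apply: closed_comp; last exact: itv_closed.
  by move=> y _; have [_] := pd u.1.1; exact.
- move=> l _ x y Kx Ky u ul; rewrite (in_dualZ _ _ (pd _)) (in_dualD _ _ (pd _)).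
  have /andP[? ?] := Kx u ul; have /andP[? ?] := Ky u ul.
  by apply/andP; split; lra.
- move=> l l' Kl Kl'; exists (l ++ l').
    by move=> u; rewrite mem_cat => /orP[/Kl|/Kl'].
  by move=> y Ky; split => u ul; apply: Ky; rewrite mem_cat ul ?orbT.
- by move=> l Kl; exists x0.
have xx0 : x = x0.
  have inK k (q1 q2 : rat) : ratr q1 < phi k x0 < ratr q2 -> ratr q1 <= phi k x <= ratr q2.
    move=> /andP[h1 h2].
    apply: (Hx [:: (k, q1, q2)] _ (k, q1, q2)); last by rewrite inE.
    by move=> u; rewrite inE => /eqP -> /=; rewrite !ltW.
  apply: tot => k; apply/eqP; case: ltgtP => // lt; exfalso.
    have [q1 hq1] := rat_in_itvoo lt.
    have [q2 hq2] := rat_in_itvoo (ltr_pwDr ltr01 (lexx (phi k x0))).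
    have /andP[] : ratr q1 <= phi k x <= ratr q2.
      by apply: inK; move: hq1 hq2; rewrite !in_itv/= => /andP[_ ->] /andP[->].
    by move: hq1; rewrite in_itv/= leNgt => /andP[->].
  have [q1 hq1] := rat_in_itvoo lt.
  have l1 : phi k x0 - 1 < phi k x0 by rewrite ltrBlDr ltrDl.
  have [q2 hq2] := rat_in_itvoo l1.
  have /andP[_] : ratr q2 <= phi k x <= ratr q1.
    by apply: inK; move: hq1 hq2; rewrite !in_itv/= => /andP[-> _] /andP[_ ->].
  by move: hq1; rewrite in_itv/= leNgt => /andP[_ ->].
rewrite xx0 in near_x.
have : nbhs x0 O by exact: open_nbhs_nbhs.
rewrite -nbhs_ballE => -[e /= e0 eO].
have [l [n [Dl n0 H]]] := near_x e e0.
have [m mn] := ltr_add_invr n0; rewrite add0r in mn.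
have ne : K l !=set0 by exists x0.
exists (pt (l, m)); split; last by exists (l, m).
have [Kp pl] := svalP (cid (adh l m)) ne.
apply: eO; rewrite -ball_normE /=; apply: (H l) => //.
by apply: le_trans pl _; rewrite lerD2l ltW.
Qed.

End milman_pettis.

(** * The normed quotient of a complete seminorm *)

(** A seminorm on a subspace of V. Completeness is stated for sequences with the
convergence rate of geometric ratio 1/4, and the limit inherits the rate. *)
Record complete_seminorm (R : realType) (V : lmodType R) := CompleteSeminorm {
  sn_dom : set V;
  sn_val :> V -> R;
  sn_dom0 : sn_dom 0;
  sn_dom_comb : forall a u v, sn_dom u -> sn_dom v -> sn_dom (a *: u + v);
  snD : forall u v, sn_dom u -> sn_dom v ->
    sn_val (u + v) <= sn_val u + sn_val v;
  snZ : forall a u, sn_dom u -> sn_val (a *: u) = `|a| * sn_val u;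
  sn_complete : forall u : nat -> V, (forall n, sn_dom (u n)) ->
    (forall n m, (n <= m)%N -> sn_val (u m - u n) <= 4^-1 ^+ n) ->
    exists2 v, sn_dom v & forall n, sn_val (v - u n) <= 4^-1 ^+ n }.

Section seminorm_quotient.
Context {R : realType} {V : lmodType R} (N : complete_seminorm V).
Local Notation W := (sn_dom N).

Let domB u v : W u -> W v -> W (u - v).
Proof. by move=> Wu Wv; rewrite addrC -scaleN1r; exact: sn_dom_comb. Qed.

Let domD u v : W u -> W v -> W (u + v).
Proof. by move=> Wu Wv; rewrite -[u]scale1r; exact: sn_dom_comb. Qed.

Let domZ a u : W u -> W (a *: u).
Proof. by move=> Wu; rewrite -[_ *: _]addr0; apply: sn_dom_comb => //; exact: sn_dom0. Qed.

Let sn0 : N 0 = 0.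
Proof. by rewrite -(scale0r 0) snZ ?normr0 ?mul0r//; exact: sn_dom0. Qed.

Let snN u : W u -> N (- u) = N u.
Proof. by move=> Wu; rewrite -scaleN1r snZ// normrN1 mul1r. Qed.

Let snB u v : W u -> W v -> N (u - v) = N (v - u).
Proof. by move=> Wu Wv; rewrite -snN ?opprB//; exact: domB. Qed.

Let sn_ge0 u : W u -> 0 <= N u.
Proof.
move=> Wu; have := snD Wu (domB (sn_dom0 N) Wu).
by rewrite sub0r subrr sn0 snN// -mulr2n pmulrn_lge0.
Qed.

Let restr (u : V) : V := if pselect (W u) then u else 0.

Let restrW u : W (restr u).
Proof. by rewrite /restr; case: pselect => //= _; exact: sn_dom0. Qed.

Let restrE u : W u -> restr u = u.
Proof. by rewrite /restr; case: pselect. Qed.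

(** Vectors outside the domain are identified with 0, so that the quotient map is
defined on all of V. *)
Definition sn_equiv (u v : V) : bool := N (restr u - restr v) == 0.

Let equiv_refl : reflexive sn_equiv.
Proof. by move=> u; rewrite /sn_equiv subrr sn0. Qed.

Let equiv_sym : symmetric sn_equiv.
Proof. by move=> u v; congr (_ == 0); exact: snB. Qed.

Let equiv_trans : transitive sn_equiv.
Proof.
move=> v u w /eqP uv /eqP vw; rewrite /sn_equiv eq_le sn_ge0 ?andbT//; last exact: domB.
rewrite -(subrKA (restr v)); apply: le_trans (snD _ _) _; [exact: domB..|].
by rewrite uv vw addr0.
Qed.

Canonical sn_equivRel := EquivRel sn_equiv equiv_refl equiv_sym equiv_trans.

Local Open Scope quotient_scope.

Definition seminorm_quotient : Type := {eq_quot sn_equivRel}.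
Local Notation Q := seminorm_quotient.
HB.instance Definition _ := Choice.on Q.
HB.instance Definition _ := EqQuotient.on Q.

Definition sn_class (u : V) : Q := \pi_Q u.

Lemma sn_class_eq u v : W u -> W v -> (sn_class u = sn_class v <-> N (u - v) = 0).
Proof.
move=> Wu Wv; split => [/eqmodP|uv].
  by rewrite /= /sn_equiv !restrE// => /eqP.
by apply/eqmodP; rewrite /= /sn_equiv !restrE// uv.
Qed.

Let lift (x : Q) : V := restr (repr x).

Let liftW x : W (lift x). Proof. exact: restrW. Qed.

Let class_restr u : sn_class (restr u) = sn_class u.
Proof.
by apply/eqmodP; rewrite /= /sn_equiv (restrE (restrW u)) subrr sn0.
Qed.

Let liftK x : sn_class (lift x) = x.
Proof. by rewrite class_restr /sn_class reprK. Qed.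

Lemma sn_class_surj x : exists2 u, W u & sn_class u = x.
Proof. by exists (lift x). Qed.

Let lift_class u : W u -> N (lift (sn_class u) - u) = 0.
Proof. by move=> Wu; apply/sn_class_eq. Qed.

Let qadd (x y : Q) : Q := sn_class (lift x + lift y).
Let qopp (x : Q) : Q := sn_class (- lift x).
Let qscale (a : R) (x : Q) : Q := sn_class (a *: lift x).
Let qnorm (x : Q) : R := N (lift x).

Let qaddE u v : W u -> W v -> qadd (sn_class u) (sn_class v) = sn_class (u + v).
Proof.
move=> Wu Wv; apply/sn_class_eq; [exact: domD..|].
rewrite opprD addrACA; apply/eqP; rewrite eq_le sn_ge0 ?andbT; last first.
  by apply: domD; exact: domB.
by apply: le_trans (snD _ _) _; [exact: domB..|rewrite !lift_class// addr0].
Qed.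

Let qscaleE a u : W u -> qscale a (sn_class u) = sn_class (a *: u).
Proof.
move=> Wu; apply/sn_class_eq; [exact: domZ..|].
by rewrite -scalerBr snZ; [rewrite lift_class// mulr0|exact: domB].
Qed.

Let qoppE u : W u -> qopp (sn_class u) = sn_class (- u).
Proof.
by move=> Wu; rewrite /qopp -scaleN1r -[sn_class _]/(qscale _ _) qscaleE// scaleN1r.
Qed.

Let qnormE u : W u -> qnorm (sn_class u) = N u.
Proof.
move=> Wu; rewrite /qnorm; apply/eqP; rewrite eq_le; apply/andP; split.
  rewrite -[leLHS]/(N _) -[X in N X](subrK u) (le_trans (snD _ _))//; first exact: domB.
  by rewrite lift_class// add0r.
rewrite -[X in N X](subrK (lift (sn_class u))) (le_trans (snD _ _))//; first exact: domB.
by rewrite snB// lift_class// add0r.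
Qed.

Let elim (P : Q -> Prop) : (forall u, W u -> P (sn_class u)) -> forall x, P x.
Proof. by move=> H x; rewrite -(liftK x); exact: H. Qed.

Let qaddA : associative qadd.
Proof.
elim/elim => u Wu; elim/elim => v Wv; elim/elim => w Ww.
by rewrite !qaddE ?addrA//; exact: domD.
Qed.

Let qaddC : commutative qadd.
Proof. by elim/elim => u Wu; elim/elim => v Wv; rewrite !qaddE// addrC. Qed.

Let qadd0 : left_id (sn_class 0) qadd.
Proof. by elim/elim => u Wu; rewrite !qaddE ?add0r//; exact: sn_dom0. Qed.

Let qaddN : left_inverse (sn_class 0) qopp qadd.
Proof.
elim/elim => u Wu; rewrite qoppE// qaddE// ?addNr//.
by rewrite -scaleN1r; exact: domZ.
Qed.

HB.instance Definition _ := GRing.isZmodule.Build Q qaddA qaddC qadd0 qaddN.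

Let qscaleA a b x : qscale a (qscale b x) = qscale (a * b) x.
Proof. by elim/elim : x => u Wu; rewrite !qscaleE ?scalerA//; exact: domZ. Qed.

Let qscale1 : left_id 1 qscale.
Proof. by elim/elim => u Wu; rewrite !qscaleE ?scale1r. Qed.

Let qscaleDr : right_distributive qscale +%R.
Proof.
move=> a; elim/elim => u Wu; elim/elim => v Wv.
rewrite -[_ + _ in LHS]/(qadd _ _) -[RHS]/(qadd _ _) qaddE// !qscaleE ?qaddE ?scalerDr//.
  exact: domZ.
  exact: domZ.
exact: domD.
Qed.

Let qscaleDl v : {morph qscale^~ v : a b / a + b}.
Proof.
move=> a b; elim/elim : v => u Wu.
rewrite -[RHS]/(qadd _ _) !qscaleE ?qaddE ?scalerDl//; exact: domZ.
Qed.

HB.instance Definition _ :=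
  GRing.Zmodule_isLmodule.Build R Q qscaleA qscale1 qscaleDr qscaleDl.

Lemma sn_class_comb a u v : W u -> W v ->
  sn_class (a *: u + v) = a *: sn_class u + sn_class v.
Proof.
move=> Wu Wv; rewrite -[RHS]/(qadd (qscale _ _) _) qscaleE// qaddE//.
exact: domZ.
Qed.

Let qnormD (x y : Q) : qnorm (x + y) <= qnorm x + qnorm y.
Proof.
elim/elim : x => u Wu; elim/elim : y => v Wv.
rewrite -[sn_class u + _]/(qadd _ _) qaddE// !qnormE//; [exact: snD|exact: domD].
Qed.

Let qnormZ (a : R) (x : Q) : qnorm (a *: x) = `|a| * qnorm x.
Proof.
elim/elim : x => u Wu.
rewrite -[_ *: sn_class u]/(qscale _ _) qscaleE// !qnormE ?snZ//; exact: domZ.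
Qed.

Let qnorm_eq0 (x : Q) : qnorm x = 0 -> x = 0.
Proof.
elim/elim : x => u Wu; rewrite qnormE// => u0.
by apply/sn_class_eq; rewrite ?subr0//; exact: sn_dom0.
Qed.

HB.instance Definition _ :=
  @Lmodule_isNormed.Build R Q qnorm qnormD qnormZ qnorm_eq0.

Lemma sn_class_norm u : W u -> `|sn_class u| = N u.
Proof. exact: qnormE. Qed.

Lemma sn_class_dist u v : W u -> W v -> `|sn_class u - sn_class v| = N (u - v).
Proof.
move=> Wu Wv; rewrite -sn_class_norm; last exact: domB.
by rewrite (addrC u) -(scaleN1r v) sn_class_comb// scaleN1r addrC.
Qed.

Let quotient_complete (F : set_system Q) :
  ProperFilter F -> cauchy F -> cvg F.
Proof.
move=> FF /cauchyP Fc.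
have r0 n : 0 < 4^-1 ^+ n / 2 :> R by rewrite divr_gt0// exprn_gt0// invr_gt0.
have [b bF] : exists b : nat -> Q, forall n, F (ball (b n) (4^-1 ^+ n / 2)).
  exists (fun n => sval (cid (Fc _ (r0 n)))) => n.
  exact: (svalP (cid (Fc _ (r0 n)))).
have bW n : W (lift (b n)) by exact: liftW.
have [|v Wv vb] := sn_complete bW.
  move=> n m nm; rewrite -sn_class_dist// !liftK.
  have [z [nz mz]] := filter_ex (filterI (bF n) (bF m)).
  rewrite -ball_normE /= in nz mz.
  apply: le_trans (ler_distD z _ _) _; rewrite (distrC z).
  have : 4^-1 ^+ m <= 4^-1 ^+ n :> R.
    by rewrite ler_wiXn2l// ?invr_ge0// invf_le1// ler1n.
  by move: nz mz => /ltW nz /ltW mz; lra.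
apply/cvg_ex; exists (sn_class v); apply/cvg_ballP => e e0.
have [n ne] : exists n, 4^-1 ^+ n * 2 < e.
  have q1 : `|4^-1 : R| < 1 by rewrite ger0_norm// invf_lt1// ltr1n.
  have /cvgrPdist_lt/(_ (e / 2)) := cvg_expr q1.
  have e20 : 0 < e / 2 by rewrite divr_gt0.
  move=> /(_ e20)[n _ /(_ n (leqnn _))] /=; rewrite sub0r normrN ger0_norm ?exprn_ge0//.
  by exists n; rewrite -ltr_pdivlMr.
apply: filterS (bF n) => z; rewrite -!ball_normE /= => bz.
have := vb n; rewrite -sn_class_dist// liftK => vbn.
apply: le_lt_trans (ler_distD (b n) _ _) _; have := r0 n; lra.
Qed.

HB.instance Definition _ := Uniform_isComplete.Build Q quotient_complete.

End seminorm_quotient.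

Section quotient_functionals.
Context {R : realType} {V : lmodType R} (N : complete_seminorm V).
Local Notation W := (sn_dom N).

Lemma sn_dom_scale a u : W u -> W (a *: u).
Proof. by move=> Wu; rewrite -[_ *: _]addr0; apply: sn_dom_comb => //; exact: sn_dom0. Qed.

(** Linearity promotes the bound on the unit ball to |f u| <= M N u, so f is constant
on classes and descends to a continuous functional. *)
Lemma seminorm_functional (f : V -> R) (M : R) :
  (forall a u v, W u -> W v -> f (a *: u + v) = a * f u + f v) ->
  (forall u, W u -> N u <= 1 -> `|f u| <= M) ->
  exists2 phi : seminorm_quotient N -> R, in_dual phi &
    forall u, W u -> phi (sn_class N u) = f u.
Proof.
move=> flin fM.
have W0 := sn_dom0 N.
have f0 : f 0 = 0 by have := flin 1 0 0 W0 W0; rewrite scaler0 addr0; lra.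
have fZ a u : W u -> f (a *: u) = a * f u.
  by move=> Wu; have := flin a u 0 Wu W0; rewrite addr0 f0 addr0.
have M0 : 0 <= M.
  apply: le_trans (fM 0 W0 _); first exact: normr_ge0.
  by rewrite -(scale0r 0) snZ// normr0 mul0r.
have fN u : W u -> `|f u| <= M * N u.
  move=> Wu; apply/ler_addgt0Pr => e e0.
  have Nu0 : 0 <= N u by rewrite -sn_class_norm.
  pose c := N u + e / (M + 1).
  have M1 : 0 < M + 1 by rewrite ltr_wpDl.
  have d0 : 0 < e / (M + 1) by rewrite divr_gt0.
  have c0 : 0 < c by rewrite ltr_wpDl.
  have := fM (c^-1 *: u) (sn_dom_scale _ Wu).
  rewrite snZ// fZ// normrM gtr0_norm ?invr_gt0// => H.
  have {}H : c^-1 * `|f u| <= M by apply: H; rewrite ler_pdivrMl// mulr1 lerDl ltW.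
  rewrite ler_pdivrMl// in H; apply: le_trans H _.
  rewrite /c mulrDl mulrC lerD2l mulrAC ler_pdivrMr// ler_pM2l//.
  by rewrite lerDl.
pose pick (x : seminorm_quotient N) : V := sval (cid2 (sn_class_surj x)).
have pickW x : W (pick x) by rewrite /pick; case: cid2.
have pickK x : sn_class N (pick x) = x by rewrite /pick; case: cid2.
pose phi (x : seminorm_quotient N) : R := f (pick x).
have phiE u : W u -> phi (sn_class N u) = f u.
  move=> Wu; apply/eqP; rewrite -subr_eq0 -normr_le0.
  (* linearity writes the difference of the two values as a value of f *)
  have -> : f u = - ((-1) * f u) by ring.
  rewrite opprK addrC /phi -flin//.
  have Wd : W (-1 *: u + pick (sn_class N u)) by exact: sn_dom_comb.
  apply: le_trans (fN _ Wd) _.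
  by rewrite scaleN1r addrC -sn_class_dist// pickK subrr normr0 mulr0.
have philin : linear (phi : _ -> R^o).
  move=> a x y; rewrite -{1}(pickK x) -{1}(pickK y) -sn_class_comb// phiE ?flin//.
  exact: sn_dom_comb.
exists phi => //; apply: (in_dual_bounded (M := M)) => // x.
by rewrite -(pickK x) phiE// sn_class_norm//; exact: fN.
Qed.

Lemma sn_class0 : sn_class N 0 = 0.
Proof.
have W0 := sn_dom0 N.
by have := sn_class_comb (-1) W0 W0; rewrite scaler0 addr0 scaleN1r addNr.
Qed.

Lemma seminorm_quotient_uniformly_convex (p : R) :
  (forall e : R, 0 < e -> exists2 C : R, 0 <= C & forall u v, W u -> W v ->
    N (u - v) `^ p + C * N (2^-1 *: (u + v)) `^ p <=
    (e + C / 2) * (N u `^ p + N v `^ p)) ->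
  power_uniformly_convex (seminorm_quotient N) p.
Proof.
move=> H e e0; have [C C0 HC] := H e e0; exists C; [exact: C0|move=> x y].
have [u Wu <-] := sn_class_surj x; have [v Wv <-] := sn_class_surj y.
have Wuv : W (u + v) by rewrite -[u]scale1r; exact: sn_dom_comb.
have W0 := sn_dom0 N.
have -> : 2^-1 *: (sn_class N u + sn_class N v) = sn_class N (2^-1 *: (u + v)).
  rewrite -[X in X + sn_class N v]scale1r -sn_class_comb// scale1r.
  by rewrite -[LHS]addr0 -sn_class0 -sn_class_comb// addr0.
rewrite sn_class_dist// !sn_class_norm//; first exact: HC.
exact: sn_dom_scale.
Qed.

Lemma seminorm_quotient_separable (p : R) (I : countType) (f : I -> V -> R) :
  0 < p -> power_uniformly_convex (seminorm_quotient N) p ->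
  (forall i a u v, W u -> W v -> f i (a *: u + v) = a * f i u + f i v) ->
  (forall i, exists M, forall u, W u -> N u <= 1 -> `|f i u| <= M) ->
  (forall u, W u -> (forall i, f i u = 0) -> N u = 0) ->
  separable_space (seminorm_quotient N).
Proof.
move=> p0 uc flin fM ftot.
have dualf i : exists2 phi : seminorm_quotient N -> R, in_dual phi &
    forall u, W u -> phi (sn_class N u) = f i u.
  have [M HM] := fM i; apply: seminorm_functional HM; exact: flin.
pose phi j : seminorm_quotient N -> R := if unpickle j is Some i then
  sval (cid2 (dualf i)) else (fun=> 0).
have phid j : in_dual (phi j).
  rewrite /phi; case: unpickle => [i|]; last exact: in_dual_zero.
  by case: cid2.
have phiE i u : W u -> phi (pickle i) (sn_class N u) = f i u.
  by move=> Wu; rewrite /phi pickleK; case: cid2 => /= ? _; exact.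
apply: (uniformly_convex_separable p0 uc phid) => x y.
have [u Wu <-] := sn_class_surj x; have [v Wv <-] := sn_class_surj y.
move=> H; apply/sn_class_eq => //.
have Wuv : W (u - v) by rewrite addrC -scaleN1r; exact: sn_dom_comb.
apply: ftot => // i; rewrite addrC -scaleN1r flin// -!phiE// H; lra.
Qed.

End quotient_functionals.

(** * Inequalities for powers of absolute values *)

Section power_inequalities.
Context {R : realType} (p : R) (p1 : 1 < p).

Let p0 : 0 < p. Proof. exact: lt_trans p1. Qed.

Lemma one_powR (r : R) : 1 `^ r = 1 :> R.
Proof. by rewrite powR1. Qed.

Lemma abs_powRM (a b : R) : `|a * b| `^ p = `|a| `^ p * `|b| `^ p.
Proof. by rewrite normrM powRM. Qed.

Lemma abs_powR_convex (s a b : R) : 0 <= s <= 1 ->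
  `|s * a + (1 - s) * b| `^ p <= s * `|a| `^ p + (1 - s) * `|b| `^ p.
Proof.
move=> /andP[s0 s1].
have si : Itv.spec (@Itv.num_sem R) (Itv.Real `[0%Z, 1%Z]) s.
  by rewrite /= /Itv.num_sem /= in_itv/= s0 s1 num_real.
have := convex_powR (ltW p1) (Itv.mk si) (x := `|a|) (y := `|b|).
rewrite !inE /= !in_itv /= !normr_ge0 => /(_ isT isT).
rewrite !convRE /= => H.
apply: le_trans H; apply: (powR_homo_le p0) => //.
apply: le_trans (ler_normD _ _) _.
by rewrite !normrM (ger0_norm s0) (ger0_norm (_ : 0 <= 1 - s))// subr_ge0.
Qed.

(* The defect of midpoint convexity of |.|^p between t and 1. *)
Let g (t : R) : R := (`|t| `^ p + 1) / 2 - `|(t + 1) / 2| `^ p.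

Let g_decr (s t : R) : 0 < s -> s < t -> t <= 1 -> g t < g s.
Proof.
move=> s0 st t1.
pose f (x : R) := 2^-1 * x `^ p - (2^-1 * x + 2^-1) `^ p.
have fE x : 0 < x -> g x = f x + 2^-1.
  move=> x0; rewrite /g /f !ger0_norm ?divr_ge0 ?addr_ge0 ?ltW//.
  by rewrite (_ : (x + 1) / 2 = 2^-1 * x + 2^-1); [ring|ring].
rewrite !fE//; last exact: lt_trans st.
rewrite ltrD2r.
pose df (x : R) := 2^-1 * (p * x `^ (p - 1)) - 2^-1 * (p * (2^-1 * x + 2^-1) `^ (p - 1)).
have fd (x : R) : 0 < x -> is_derive x 1 f (df x).
  move=> x0; apply: is_deriveB.
    by apply: is_deriveZ; exact: is_derive1_powR.
  have h : is_derive x 1 (2^-1 \*: id + cst 2^-1 : R -> R) (2^-1 *: 1 + 0).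
    exact: is_deriveD.
  have h2 : 0 < (2^-1 \*: id + cst 2^-1 : R -> R) x.
    by rewrite /= fctE /= /GRing.scale/=; lra.
  have := is_derive1_comp (is_derive1_powR p h2) h.
  rewrite addr0 /GRing.scale /= mulr1 => H.
  by rewrite mulrC; exact: H.
have [||c cst H] := @MVT R f df s t st.
- by move=> x; rewrite in_itv/= => /andP[sx _]; apply: fd; exact: lt_trans sx.
- apply: derivable_within_continuous => x; rewrite in_itv/= => /andP[sx _].
  by have [] := fd x (lt_le_trans s0 sx).
move: cst; rewrite in_itv/= => /andP[sc ct].
have c0 := lt_trans s0 sc.
rewrite -subr_lt0 H nmulr_rlt0 ?subr_gt0// /df -mulrBr -mulrBr.
rewrite pmulr_rlt0 ?invr_gt0// pmulr_rlt0// subr_lt0.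
have p10 : 0 < p - 1 by rewrite subr_gt0.
by apply: (gt0_ltr_powR p10); rewrite ?nnegrE; lra.
Qed.

Let g1 : g 1 = 0.
Proof. by rewrite /g -mulr2n divff// normr1 powR1; lra. Qed.

(* For t <= 0 the midpoint is at most 1/2, where the p-th power is below 1/2;
   by a margin this persists for small positive t, so that the derivative of the
   p-th power is only needed away from 0. *)
Let g_low : exists d : R, [/\ 0 < d, d < 1 & exists2 c, 0 < c &
  forall t, - 1 <= t -> t <= d -> c <= g t].
Proof.
pose a : R := 2^-1 `^ p^-1.
have a2 : a `^ p = 2^-1 by rewrite /a -powRrM mulVf ?gt_eqF// powRr1.
have a0 : 0 < a by rewrite powR_gt0.
have a12 : 2^-1 < a.
  apply: (powR_lt_cancel p0 (ltW a0)); rewrite a2.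
  have := @gt0_ltr_powR R (p - 1); rewrite subr_gt0 => /(_ p1 2^-1 1).
  rewrite !nnegrE => /(_ _ _ _) H.
  rewrite -[X in X `^ p](mulr1) powRM// powR1 mulr1.
  rewrite -(mulr_powRB1 _ p0)// -[ltRHS]mulr1 ltr_pM2l//.
  by rewrite powR1 in H; apply: H => //; lra.
have a1 : a < 1.
  by apply: (powR_lt_cancel p0 ler01); rewrite a2 powR1; lra.
pose m := (a + 2^-1) / 2.
exists (2 * m - 1); split; [rewrite /m; lra|rewrite /m; lra|].
have mp : m `^ p < 2^-1.
  by rewrite -a2; apply: (gt0_ltr_powR p0); rewrite ?nnegrE /m; lra.
exists (2^-1 - m `^ p); first by rewrite subr_gt0.
move=> t t1 td; rewrite /g.
have : `|(t + 1) / 2| `^ p <= m `^ p.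
  apply: (powR_homo_le p0) => //; rewrite ger0_norm; last lra.
  by lra.
by have := powR_ge0 `|t| p; lra.
Qed.

Let g_ge0 t : - 1 <= t <= 1 -> 0 <= g t.
Proof.
move=> /andP[t1 t2]; have [d [d0 d1 [c c0 H]]] := g_low.
have [td|td] := leP t d; first exact: le_trans (ltW c0) (H _ t1 td).
have [->|tn1] := eqVneq t 1; first by rewrite g1.
rewrite -g1; apply/ltW/g_decr => //; first exact: lt_trans td.
by rewrite lt_neqAle tn1.
Qed.

Let g_uniform (e : R) : 0 < e -> exists2 C, 0 <= C &
  forall t, - 1 <= t <= 1 -> `|t - 1| `^ p <= e + C * g t.
Proof.
move=> e0; pose d' := Num.min (e `^ p^-1) 2^-1.
have d'0 : 0 < d' by rewrite lt_min powR_gt0//=; lra.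
have d'1 : d' <= 2^-1 by rewrite ge_min lexx orbT.
have [d [d0 d1 [c c0 H]]] := g_low.
pose c1 := Num.min c (g (1 - d')).
have g0 : 0 < g (1 - d') by rewrite -g1; apply: g_decr; lra.
have c10 : 0 < c1 by rewrite lt_min c0.
exists (2 `^ p / c1); first by rewrite divr_ge0// ?powR_ge0// ltW.
move=> t t11; have /andP[t1 t2] := t11.
have [td|td] := leP (1 - d') t.
  apply: ler_wpDr; first by rewrite mulr_ge0 ?g_ge0// divr_ge0// ?powR_ge0// ltW.
  have -> : e = (e `^ p^-1) `^ p.
    by rewrite -powRrM mulVf ?gt_eqF// powRr1// ltW.
  apply: (powR_homo_le p0) => //; apply: (@le_trans _ _ d'); last by rewrite ge_min lexx.
  by rewrite distrC ger0_norm; lra.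
have cg : c1 <= g t.
  have [tl|tl] := leP t d; first by rewrite ge_min H.
  have gt : g (1 - d') < g t by apply: g_decr => //; [exact: lt_trans tl|lra].
  by rewrite ge_min (ltW gt) orbT.
apply: ler_wpDl; first exact: ltW.
apply: (@le_trans _ _ (2 `^ p)).
  by apply: (powR_homo_le p0) => //; rewrite distrC ger0_norm; lra.
by rewrite -mulrA ler_peMr ?powR_ge0// mulrC ler_pdivlMr// mul1r.
Qed.

(** By homogeneity one may take b = 1 and |a| <= 1. Then |a - 1|^p is small near
a = 1, and away from a = 1 the midpoint defect is bounded below. *)
Lemma abs_powR_uniformly_convex (e : R) : 0 < e -> exists2 C, 0 <= C &
  forall a b : R, `|a - b| `^ p + C * `|2^-1 * (a + b)| `^ p <=
    (e + C / 2) * (`|a| `^ p + `|b| `^ p).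
Proof.
move=> e0; have [C C0 H] := g_uniform e0; exists C => //.
suff main (a b : R) : `|a| <= `|b| ->
    `|a - b| `^ p + C * `|2^-1 * (a + b)| `^ p <=
    (e + C / 2) * (`|a| `^ p + `|b| `^ p).
  move=> a b; have [/main//|/ltW/main] := leP `|a| `|b|.
  by move=> {}H; rewrite distrC (addrC a) (addrC (`|a| `^ p)).
have [->|b0] := eqVneq b 0.
  rewrite normr0 normr_le0 => /eqP ->; rewrite subr0 addr0 mulr0 normr0.
  by rewrite powR0 ?gt_eqF// !(mulr0,addr0).
move=> ab; pose t := a / b.
have at_ : a = t * b by rewrite /t divfK.
have bp : 0 < `|b| `^ p by rewrite powR_gt0// normr_gt0.
have t1 : - 1 <= t <= 1.
  by rewrite -ler_norml /t normf_div ler_pdivrMr ?normr_gt0// mul1r.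
rewrite at_ (_ : t * b - b = (t - 1) * b); last by ring.
rewrite (_ : 2^-1 * (t * b + b) = ((t + 1) / 2) * b); last by ring.
rewrite (abs_powRM (t - 1)) (abs_powRM ((t + 1) / 2)) (abs_powRM t).
have := H t t1; rewrite /g; set A := `|t - 1| `^ p; set B := `|t| `^ p.
set D := `|(t + 1) / 2| `^ p; set P := `|b| `^ p => HA.
have B0 : 0 <= B by exact: powR_ge0.
have HH : A + C * D <= (e + C / 2) * (B + 1).
  by have := mulr_ge0 (ltW e0) B0; lra.
by have := ler_wpM2r (ltW bp) HH; rewrite -/P; lra.
Qed.

Lemma powR_triangle_le (a b : R) :
  `|b| `^ p <= 2 `^ p * (`|a| `^ p + `|a - b| `^ p).
Proof.
pose M := Num.max `|a| `|a - b|.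
have bM : `|b| <= 2 * M.
  have : `|b| <= `|a| + `|a - b| by rewrite -{1}(subKr a b) ler_normB.
  have : `|a| <= M by rewrite le_max lexx.
  have : `|a - b| <= M by rewrite le_max lexx orbT.
  lra.
have M0 : (0 <= M)%R by rewrite le_max normr_ge0.
apply: (le_trans (powR_homo_le p0 _ bM)) => //; rewrite powRM//.
rewrite ler_wpM2l ?powR_ge0// /M.
by case: (leP `|a| `|a - b|) => _; rewrite ?(lerDl, lerDr); exact: powR_ge0.
Qed.

End power_inequalities.

(** * Integrals of powers *)

Lemma continuous_abs_powR {R : realType} (p : R) : 0 < p ->
  continuous (fun t : R => `|t| `^ p).
Proof.
move=> p0 t; have [->|t0] := eqVneq t 0.
  apply/cvgrPdist_lt => e e0.
  near=> x; rewrite normr0 powR0 ?gt_eqF// sub0r normrN ger0_norm ?powR_ge0//.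
  have -> : e = (e `^ p^-1) `^ p by rewrite -powRrM mulVf ?gt_eqF// powRr1// ltW.
  apply: (gt0_ltr_powR p0); rewrite ?nnegrE ?powR_ge0//.
  near: x; have : 0 < e `^ p^-1 by rewrite powR_gt0.
  move=> e'0; apply: filterS (nbhsx_ballx (0 : R) _ e'0) => x.
  by rewrite -ball_normE /= sub0r normrN.
apply: (@continuous_comp _ _ _ (@Num.norm _ R) (@powR R ^~ p)); first exact: norm_continuous.
apply: differentiable_continuous; apply/derivable1_diffP.
by apply: derivable_powR; rewrite in_itv/= andbT normr_gt0.
Unshelve. all: by end_near. Qed.

Lemma cvg_abs_powR {R : realType} (p : R) (u : nat -> R) (l : R) : 0 < p ->
  u n @[n --> \oo] --> l -> (fun n => `|u n| `^ p : R) @ \oo --> (`|l| `^ p : R).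
Proof.
move=> p0 ul.
have c := @continuous_abs_powR R p p0 l.
exact: (cvg_comp (u : nat -> R) _ ul c).
Qed.

Section limn_einf.
Context {R : realType}.
Local Open Scope ereal_scope.

Lemma limn_einfD_le (a b : (\bar R)^nat) (c : \bar R) :
  (forall n, 0 <= a n) -> (forall n, 0 <= b n) -> (forall n, a n + b n <= c) ->
  limn_einf a + limn_einf b <= c.
Proof.
move=> a0 b0 abc; rewrite !limn_einf_lim.
have e0 (u : (\bar R)^nat) n : (forall n, 0 <= u n) -> 0 <= einfs u n.
  by move=> u0; apply: le_ereal_inf_tmp => _ [k _ <-]; exact: u0.
have l0 (u : (\bar R)^nat) : (forall n, 0 <= u n) -> 0 <= limn (einfs u).
  by move=> u0; apply: lime_ge; [exact: is_cvg_einfs|apply: nearW => n; exact: e0].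
have ab : limn (einfs a) +? limn (einfs b).
  by apply: ge0_adde_def; rewrite inE l0.
rewrite -limeD//; [|exact: is_cvg_einfs..].
apply: lime_le; first by apply: is_cvgeD => //; exact: is_cvg_einfs.
apply: nearW => n; apply: le_trans (abc n); apply: leeD.
  by apply: ereal_inf_lbound; exists n => /=.
by apply: ereal_inf_lbound; exists n => /=.
Qed.

End limn_einf.

Section power_integral.
Context {R : realType} (p : R) (p1 : 1 < p).
Context d (X : measurableType d) (m : {measure set X -> \bar R}).
Variables (A : set X) (mA : measurable A) (w : X -> R).
Hypotheses (w0 : forall x, A x -> 0 <= w x) (mw : measurable_fun A w).
Implicit Types f : X -> R.
Local Open Scope ereal_scope.

Let p0 : (0 < p)%R. Proof. exact: lt_trans p1. Qed.

Definition power_integral (m : {measure set X -> \bar R}) (A : set X)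
  (w : X -> R) f : \bar R := \int[m]_(x in A) (`|f x| `^ p * w x)%:E.
Local Notation M := (power_integral m A w).

Let integrand_ge0 f x : A x -> 0 <= (`|f x| `^ p * w x)%:E.
Proof. by move=> Ax; rewrite lee_fin mulr_ge0 ?powR_ge0 ?w0. Qed.

Lemma measurable_power f : measurable_fun A f ->
  measurable_fun A (fun x => (`|f x| `^ p * w x)%:E).
Proof.
move=> mf; apply/measurable_EFinP; apply: measurable_funM => //.
apply: (measurableT_comp (measurable_powR _)).
exact: measurableT_comp.
Qed.

Lemma power_integral_ge0 f : 0 <= M f.
Proof. by apply: integral_ge0 => x Ax; exact: integrand_ge0. Qed.

Lemma eq_power_integral f g : {in A, f =1 g} -> M f = M g.
Proof. by move=> fg; apply: eq_integral => x Ax; rewrite fg. Qed.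

Lemma power_integral_ineq f1 f2 f3 f4 (c1 c2 c3 c4 : R) :
  measurable_fun A f1 -> measurable_fun A f2 ->
  measurable_fun A f3 -> measurable_fun A f4 ->
  (0 <= c1)%R -> (0 <= c2)%R -> (0 <= c3)%R -> (0 <= c4)%R ->
  (forall x, A x -> c1 * `|f1 x| `^ p + c2 * `|f2 x| `^ p <=
                    c3 * `|f3 x| `^ p + c4 * `|f4 x| `^ p)%R ->
  c1%:E * M f1 + c2%:E * M f2 <= c3%:E * M f3 + c4%:E * M f4.
Proof.
move=> m1 m2 m3 m4 c10 c20 c30 c40 H.
have S (c c' : R) f f' : measurable_fun A f -> measurable_fun A f' ->
    (0 <= c)%R -> (0 <= c')%R -> c%:E * M f + c'%:E * M f' =
    \int[m]_(x in A) (c%:E * (`|f x| `^ p * w x)%:E + c'%:E * (`|f' x| `^ p * w x)%:E).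
  move=> mf mf' c0 c'0; rewrite ge0_integralD//.
  - by rewrite !ge0_integralZl_EFin//;
      first [exact: measurable_power|move=> x; exact: integrand_ge0].
  - by move=> x Ax; rewrite mule_ge0 ?integrand_ge0// lee_fin.
  - by apply: measurable_funeM; exact: measurable_power.
  - by move=> x Ax; rewrite mule_ge0 ?integrand_ge0// lee_fin.
  - by apply: measurable_funeM; exact: measurable_power.
rewrite (S _ _ _ _ m1 m2 c10 c20) (S _ _ _ _ m3 m4 c30 c40).
apply: ge0_le_integral; first exact: mA.
- by move=> x Ax; rewrite adde_ge0// mule_ge0 ?integrand_ge0// lee_fin.
- by apply: emeasurable_funD; apply: measurable_funeM; exact: measurable_power.
- by apply: emeasurable_funD; apply: measurable_funeM; exact: measurable_power.
- move=> x Ax; rewrite -!EFinM -!EFinD lee_fin !mulrA -!mulrDl.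
  by apply: ler_wpM2r; [exact: w0|exact: H].
Qed.

Lemma power_integral_fatou (f : nat -> X -> R) (g : X -> R) :
  (forall n, measurable_fun A (f n)) -> measurable_fun A g ->
  {ae m, forall x, A x -> f n x @[n --> \oo] --> g x} ->
  M g <= limn_einf (fun n => M (f n)).
Proof.
move=> mf mg fg.
have := @fatou _ X R m A mA (fun n x => (`|f n x| `^ p * w x)%:E).
move=> /(_ (fun n => measurable_power (mf n)) (fun n x => @integrand_ge0 (f n) x)).
apply: le_trans; apply: ae_ge0_le_integral => //.
- by move=> x Ax; exact: integrand_ge0.
- exact: measurable_power.
- move=> x Ax; rewrite limn_einf_lim; apply: lime_ge; first exact: is_cvg_einfs.
  by apply: nearW => n; apply: le_ereal_inf_tmp => _ [k _ <-]; exact: integrand_ge0.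
- rewrite (_ : (fun x => _) =
      (fun x => - limn_esup (-%E \o (fun n => (`|f n x| `^ p * w x)%:E)))).
    apply: measurableT_comp => //; apply: measurable_fun_limn_esup => n.
    by apply: measurableT_comp => //; exact: measurable_power.
  by apply/funext => x; rewrite limn_esupN oppeK.
- apply: filterS fg => x fgx Ax.
  have cv : (`|f n x| `^ p * w x)%:E @[n --> \oo] --> (`|g x| `^ p * w x)%:E.
    apply: cvg_EFin; first exact: nearW.
    exact: (cvgM (cvg_abs_powR p0 (fgx Ax)) (cvg_cst (w x))).
  by rewrite (is_cvg_limn_einfE (cvgP _ cv)) (cvg_lim _ cv).
Qed.

End power_integral.

Section fast_sequences.
Context {R : realType} (p : R) (p1 : 1 < p).

Let p0 : 0 < p. Proof. exact: lt_trans p1. Qed.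

Lemma cvgn_of_geometric_increments (f : nat -> R) (K : R) :
  (forall n, `|f n.+1 - f n| <= K * 2^-1 ^+ n) -> cvgn f.
Proof.
move=> fK.
have c : cvgn (series (telescope f)).
  apply: normed_cvg; apply: (@series_le_cvg _ _ (geometric K 2^-1)).
  - by move=> n; exact: normr_ge0.
  - by move=> n; apply: le_trans (fK n); exact: normr_ge0.
  - by move=> n; exact: fK.
  - by apply: is_cvg_geometric_series; rewrite ger0_norm// invf_lt1// ltr1n.
rewrite (_ : f = (fun n => f 0 + series (telescope f) n)); last first.
  by apply/funext => n; rewrite -eq_sum_telescope.
by apply: is_cvgD => //; exact: is_cvg_cst.
Qed.

Context d (X : measurableType d) (m : {measure set X -> \bar R}).

(** The series of 2^(n p) |f n.+1 - f n|^p has a finite integral, hence a finite sum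
almost everywhere, and then the increments are dominated by a geometric
sequence of ratio 1/2. *)
Lemma ae_cvg_fast (A : set X) (f : nat -> X -> R) (C : R) :
  measurable A -> (forall n, measurable_fun A (f n)) -> 0 <= C ->
  (forall n, (power_integral p m A (cst 1%R) (fun x => f n.+1 x - f n x)%R <=
     (C * (4^-1 ^+ n) `^ p)%R%:E)%E) ->
  {ae m, forall x, A x -> cvgn (fun n => f n x)}.
Proof.
move=> mA mf C0 H.
(* 2^n against the given rate 4^-n leaves a summable series *)
pose c n := (2 ^+ n) `^ p : R.
have c0 n : 0 <= c n by exact: powR_ge0.
pose g n x := ((c n)%:E * (`|f n.+1 x - f n x| `^ p * cst 1 x)%R%:E)%E.
have g0 n x : A x -> (0 <= g n x)%E.
  by move=> _; rewrite /g -EFinM lee_fin !mulr_ge0 ?powR_ge0//=.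
have mpw n : measurable_fun A (fun x => (`|f n.+1 x - f n x| `^ p * cst 1 x)%:E).
  by apply: measurable_power => //; exact: measurable_funB.
have mg n : measurable_fun A (g n) by exact: measurable_funeM.
pose G x := (\sum_(n <oo) g n x)%E.
have mG : measurable_fun A G.
  by apply: ge0_emeasurable_sum => // n x Ax _; exact: g0.
have G0 x : A x -> (0 <= G x)%E by move=> Ax; apply: nneseries_ge0 => n _ _; exact: g0.
have intG : (\int[m]_(x in A) G x < +oo)%E.
  rewrite integral_nneseries//.
  have le n : (\int[m]_(x in A) g n x <= ((2 * C) / (2 ^ (n + 1))%:R)%:E)%E.
    rewrite /g ge0_integralZl_EFin//; last first.
      by move=> x _; rewrite lee_fin mulr_ge0 ?powR_ge0//=.
    apply: le_trans (lee_wpmul2l _ (H n)) _; first by rewrite lee_fin.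
    rewrite -EFinM lee_fin /c mulrCA -powRM ?exprn_ge0// -exprMn.
    rewrite (_ : (2 * 4^-1 : R) = 2^-1); last by lra.
    rewrite addn1 natrX exprS -mulf_div divff// mul1r ler_wpM2l// -exprVn.
    apply: ge1r_powR; last exact: ltW.
    by rewrite exprn_gt0 ?invr_gt0//= exprn_ile1// invf_le1// ler1n.
  apply: le_lt_trans (lee_nneseries _ _) _ => [n _ _|n _|].
  - by apply: integral_ge0 => x; exact: g0.
  - exact: le.
  have -> : (\sum_(n <oo) ((2 * C) / (2 ^ (n + 1))%:R)%:E = (2 * C / 2 ^+ 0)%:E)%E.
    have := @cvg_geometric_eseries_half R (2 * C) 0.
    by move/(cvg_lim (@ereal_hausdorff R)) => <-.
  by rewrite ltry.
have iG : m.-integrable A G.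
  apply/integrableP; split => //; apply: le_lt_trans intG.
  apply: ge0_le_integral => //; first exact: measurableT_comp.
  by move=> x Ax; rewrite gee0_abs// G0.
apply: filterS (integrable_ae mA iG) => x fin Ax.
have {fin}Gfin := fin Ax.
pose K := fine (G x).
have K0 : 0 <= K by rewrite fine_ge0// G0.
apply: (@cvgn_of_geometric_increments _ (K `^ p^-1)) => n.
have gK : c n * `|f n.+1 x - f n x| `^ p <= K.
  rewrite -lee_fin fineK// /G.
  have := @nneseries_lim_ge _ (g ^~ x) xpredT 0 n.+1 (fun n _ _ => @g0 n x Ax).
  apply: le_trans; rewrite big_nat_recr//= /g /= mulr1 EFinM leeDr//.
  by apply: sume_ge0 => i _; exact: g0.
have e2 : 0 < 2 ^+ n :> R by exact: exprn_gt0.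
rewrite exprVn ler_pdivlMr// mulrC.
rewrite leNgt; apply/negP => /(gt0_ltr_powR p0).
rewrite !nnegrE powR_ge0 mulr_ge0// ?ltW// => /(_ isT isT).
by rewrite -powRrM mulVf ?gt_eqF// powRr1// powRM// ?ltW// ltNge gK.
Qed.

End fast_sequences.

Section null_on_pi_system.
Context {R : realType} d (T : measurableType d).
Variable mu : {measure set T -> \bar R}.
Local Open Scope ereal_scope.

(** The measurable sets A on which the integral of f over A and D vanishes form a
Dynkin system. *)
Lemma ae_zero_of_pi_system (G : set (set T)) (D : set T) (f : T -> \bar R) :
  @measurable _ T = <<s G >> -> setI_closed G -> G setT ->
  measurable D -> mu.-integrable D f ->
  (forall A, G A -> \int[mu]_(x in A `&` D) f x = 0) ->
  {ae mu, forall x, D x -> f x = 0}.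
Proof.
move=> gG GI GT mD fi H.
have main A : measurable A -> \int[mu]_(x in A `&` D) f x = 0.
  rewrite gG; move: A.
  apply: (@dynkin_induction _ T G (fun A => \int[mu]_(x in A `&` D) f x = 0) gG GI) => //.
  - by apply: H.
  - move=> A mA A0.
    have := H _ GT; rewrite setTI.
    rewrite {1}(_ : D = (A `&` D) `|` (~` A `&` D)); last first.
      by rewrite -setIUl setUv setTI.
    rewrite integral_setU//; first by rewrite A0 add0e.
    + exact: measurableI.
    + by apply: measurableI => //; exact: measurableC.
    + by rewrite -setIUl setUv setTI; exact: measurable_int fi.
    + by apply/disj_setPS => x [[? _] [? _]].
  - move=> F mF tF F0; rewrite setI_bigcupl integral_bigcup//.
    + by rewrite eseries0.
    + exact: trivIset_setIr.
    + by move=> n; exact: measurableI.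
    + apply: integrableS fi => //; last by move=> x [n _ []].
      by apply: bigcupT_measurable => n; exact: measurableI.
have := @integral_ae_eq _ T R mu D mD (cst 0) f fi (measurable_cst _).
apply => E ED mE; rewrite integral0; have := main E mE.
by rewrite setIidl.
Qed.

End null_on_pi_system.

(** * Function spaces given by a power modular *)

(** The properties of a p-th power energy that make its p-th root the norm of a
separable reflexive space. Inequalities between powers of two linear
combinations include convexity, homogeneity and uniform convexity as special
cases; the exhaustion says that the modular controls the L^p norm locally. *)
Record power_modular {R : realType} (p : R) d (T : measurableType d)
    (mu : {measure set T -> \bar R}) (S : set T) := PowerModular {
  pm_val :> (T -> R) -> \bar R;
  pm_ge0 : forall u, (0 <= pm_val u)%E;
  pm0 : pm_val (0 : T -> R) = 0%E;
  pm_ineq : forall (a1 b1 a2 b2 c1 c2 c3 c4 : R) (u v : T -> R),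
    measurable_fun S u -> measurable_fun S v ->
    0 <= c1 -> 0 <= c2 -> 0 <= c3 -> 0 <= c4 ->
    (forall a b : R,
      c1 * `|a1 * a + b1 * b| `^ p + c2 * `|a2 * a + b2 * b| `^ p <=
      c3 * `|a| `^ p + c4 * `|b| `^ p) ->
    (c1%:E * pm_val (fun x => a1 * u x + b1 * v x)%R +
     c2%:E * pm_val (fun x => a2 * u x + b2 * v x)%R <=
     c3%:E * pm_val u + c4%:E * pm_val v)%E;
  pm_fatou : forall (u : nat -> T -> R) (v : T -> R) (c : \bar R),
    (forall n, measurable_fun S (u n)) -> measurable_fun S v ->
    {ae mu, forall x, S x -> u n x @[n --> \oo] --> v x} ->
    (forall n, pm_val (u n) <= c)%E -> (pm_val v <= c)%E;
  pm_exhaustion : exists F : nat -> set T,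
    [/\ forall n, measurable (F n), forall n, (mu (F n) < +oo)%E,
        forall n, F n `<=` S,
        forall n, exists2 C, 0 <= C & forall u, measurable_fun S u ->
          (power_integral p mu (F n) (cst 1%R) u <= C%:E * pm_val u)%E &
        {ae mu, forall x, S x -> exists n, F n x}] }.

Section modular_space.
Context {R : realType} (p : R) (p1 : 1 < p) d (T : measurableType d).
Variables (mu : {measure set T -> \bar R}) (S : set T) (mS : measurable S).
Variable E : power_modular p mu S.
Implicit Types u v : T -> R.

Let p0 : (0 < p)%R. Proof. exact: lt_trans p1. Qed.

Definition modular_dom : set (T -> R) := [set u | measurable_fun S u /\ (E u < +oo)%E].
Definition modular_norm u : R := fine (E u) `^ p^-1.

Lemma modular_fin u : modular_dom u -> E u = (fine (E u))%:E.
Proof. by move=> [_ h]; rewrite fineK// ge0_fin_numE// pm_ge0. Qed.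

Lemma modular_normK u : modular_norm u `^ p = fine (E u).
Proof. by rewrite /modular_norm -powRrM mulVf ?gt_eqF// powRr1// fine_ge0// pm_ge0. Qed.

Lemma modular_norm_ge0 u : 0 <= modular_norm u. Proof. exact: powR_ge0. Qed.

Lemma modular_norm_le u (a : R) : modular_dom u -> 0 <= a ->
  (E u <= (a `^ p)%:E)%E <-> modular_norm u <= a.
Proof.
move=> Wu a0; rewrite modular_fin// lee_fin -modular_normK; split; last first.
  by apply: (powR_homo_le p0); exact: modular_norm_ge0.
move=> h; rewrite leNgt; apply/negP => /(gt0_ltr_powR p0).
by rewrite !nnegrE modular_norm_ge0 a0 => /(_ isT isT); rewrite ltNge h.
Qed.

Lemma modular_dom_comb (a b : R) u v : modular_dom u -> modular_dom v ->
  modular_dom (fun x => a * u x + b * v x).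
Proof.
move=> [mu_ Eu] [mv Ev]; split.
  by apply: measurable_funD; apply: measurable_funM => //; exact: measurable_cst.
have := @pm_ineq _ _ _ _ _ _ E a b 0 0 1 0
  (2 `^ p * `|a| `^ p) (2 `^ p * `|b| `^ p) u v mu_ mv.
rewrite !mulr_ge0 ?powR_ge0// => /(_ ler01 (lexx _) isT isT) H.
rewrite -[X in (X < _)%E]mul1e -[X in (X < _)%E]adde0.
rewrite -[X in (_ + X < _)%E](mul0e (E (fun x => 0 * u x + 0 * v x))).
apply: le_lt_trans (H _) _.
  move=> x y; rewrite mul1r mul0r addr0 -!mulrA -!abs_powRM// -mulrDr.
  apply: le_trans (powR_triangle_le p1 (a * x) _) _.
  by rewrite opprD addrA subrr sub0r normrN.
have c0 (c : R) : (0 <= (2 `^ p * `|c| `^ p)%:E)%E.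
  by rewrite lee_fin mulr_ge0 ?powR_ge0.
apply: lte_add_pinfty; apply: lte_mul_pinfty; try exact: c0; try exact: fin_numE.
  exact: Eu.
exact: Ev.
Qed.

Lemma fine_modular_ineq (a1 b1 a2 b2 c1 c2 c3 c4 : R) u v :
  modular_dom u -> modular_dom v -> 0 <= c1 -> 0 <= c2 -> 0 <= c3 -> 0 <= c4 ->
  (forall a b : R, c1 * `|a1 * a + b1 * b| `^ p + c2 * `|a2 * a + b2 * b| `^ p <=
    c3 * `|a| `^ p + c4 * `|b| `^ p) ->
  c1 * fine (E (fun x => a1 * u x + b1 * v x)) +
  c2 * fine (E (fun x => a2 * u x + b2 * v x)) <=
  c3 * fine (E u) + c4 * fine (E v).
Proof.
move=> Wu Wv c10 c20 c30 c40 H.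
have := pm_ineq E (proj1 Wu) (proj1 Wv) c10 c20 c30 c40 H.
rewrite (modular_fin Wu) (modular_fin Wv) (modular_fin (modular_dom_comb a1 b1 Wu Wv)).
by rewrite (modular_fin (modular_dom_comb a2 b2 Wu Wv)) -!EFinM -!EFinD lee_fin.
Qed.

Lemma modular_dom0 : modular_dom (0 : T -> R).
Proof.
split; first exact: measurable_cst.
by rewrite pm0 ltry.
Qed.

Lemma modular_dom_lin (a : R) u v : modular_dom u -> modular_dom v ->
  modular_dom (a *: u + v).
Proof.
move=> Wu Wv; rewrite (_ : a *: u + v = fun x => a * u x + 1 * v x).
  exact: modular_dom_comb.
by apply/funext => x; rewrite mul1r.
Qed.

Lemma fine_modularZ (a : R) u : modular_dom u ->
  fine (E (a *: u)) = `|a| `^ p * fine (E u).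
Proof.
move=> Wu; apply/eqP; rewrite eq_le; apply/andP.
have cE (c : R) : c *: u = (fun x => c * u x + 0 * u x).
  by apply/funext => x; rewrite mul0r addr0.
have one (c c1 c2 : R) : 0 <= c1 -> 0 <= c2 ->
    (forall a : R, c1 * `|c * a| `^ p <= c2 * `|a| `^ p) ->
    c1 * fine (E (c *: u)) <= c2 * fine (E u).
  move=> c10 c20 H.
  have := @fine_modular_ineq c 0 0 0 c1 0 c2 0 u u Wu Wu c10 (lexx _) c20 (lexx _).
  by rewrite -cE !mul0r !addr0; apply => x y; rewrite !mul0r !addr0; exact: H.
split.
  have := @one a 1 (`|a| `^ p) ler01 (powR_ge0 _ _); rewrite mul1r; apply => x.
  by rewrite mul1r abs_powRM.
have Wau : modular_dom (a *: u) by rewrite cE; exact: modular_dom_comb.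
have [->|a0] := eqVneq a 0.
  by rewrite normr0 powR0 ?gt_eqF// mul0r fine_ge0// pm_ge0.
have e : `|a| `^ p != 0 by rewrite gt_eqF// powR_gt0// normr_gt0.
have := @fine_modular_ineq a^-1 0 0 0 (`|a| `^ p) 0 1 0 (a *: u) u Wau Wu
  (powR_ge0 _ _) (lexx _) ler01 (lexx _).
rewrite !mul0r !addr0 mul1r (_ : (fun x => a^-1 * _ + _) = u).
  apply => x y; rewrite !mul0r !addr0 mul1r -abs_powRM mulrA divff// mul1r.
  exact: lexx.
by apply/funext => x; rewrite mul0r addr0 /= mulrA mulVf// mul1r.
Qed.

Lemma modular_normZ (a : R) u : modular_dom u ->
  modular_norm (a *: u) = `|a| * modular_norm u.
Proof.
move=> Wu; rewrite /modular_norm fine_modularZ// powRM ?powR_ge0//; last first.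
  by rewrite fine_ge0// pm_ge0.
by rewrite -powRrM divff ?gt_eqF// powRr1.
Qed.

(** The unit ball is convex: with a and b slightly larger than the norms of u and v,
(u + v)/(a + b) is a convex combination of u/a and v/b. *)
Lemma modular_normD u v : modular_dom u -> modular_dom v ->
  modular_norm (u + v) <= modular_norm u + modular_norm v.
Proof.
move=> Wu Wv; apply/ler_addgt0Pr => e e0.
pose a := modular_norm u + e / 2; pose b := modular_norm v + e / 2.
have a0 : 0 < a by rewrite ltr_wpDl ?modular_norm_ge0// divr_gt0.
have b0 : 0 < b by rewrite ltr_wpDl ?modular_norm_ge0// divr_gt0.
have ab : 0 < a + b by exact: addr_gt0.
rewrite (_ : modular_norm u + _ + e = a + b); last by rewrite /a /b; lra.
have Wuv : modular_dom (u + v) by rewrite -[u]scale1r; exact: modular_dom_lin.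
apply/(modular_norm_le Wuv (ltW ab)).
have unit w (c : R) : 0 < c -> modular_dom w -> modular_norm w <= c ->
    fine (E (c^-1 *: w)) <= 1.
  move=> c0 Ww wc; rewrite fine_modularZ// -modular_normK -powRM//; last first.
    exact: modular_norm_ge0.
  rewrite -[leRHS](one_powR p); apply: (powR_homo_le p0).
    by rewrite mulr_ge0// modular_norm_ge0.
  by rewrite gtr0_norm ?invr_gt0// ler_pdivrMl// mulr1.
have WZ (c : R) w : modular_dom w -> modular_dom (c *: w).
  by move=> Ww; rewrite -[_ *: _]addr0; apply: modular_dom_lin => //; exact: modular_dom0.
have Wa := WZ a^-1 _ Wu; have Wb := WZ b^-1 _ Wv.
have ua : fine (E (a^-1 *: u)) <= 1 by apply: unit => //; rewrite lerDl divr_ge0// ltW.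
have ub : fine (E (b^-1 *: v)) <= 1 by apply: unit => //; rewrite lerDl divr_ge0// ltW.
pose s := a / (a + b).
have s01 : 0 <= s <= 1.
  apply/andP; split; first by apply: divr_ge0; exact: ltW.
  by rewrite ler_pdivrMr// mul1r lerDl ltW.
have /andP[s0 s1] := s01.
have s1' : 0 <= 1 - s by rewrite subr_ge0.
have := @fine_modular_ineq s (1 - s) 0 0 1 0 s (1 - s) _ _ Wa Wb ler01 (lexx _) s0 s1'.
rewrite mul0r addr0 mul1r.
have -> : (fun x => s * (a^-1 *: u) x + (1 - s) * (b^-1 *: v) x) = (a + b)^-1 *: (u + v).
  apply/funext => x.
  change (a / (a + b) * (a^-1 * u x) + (1 - a / (a + b)) * (b^-1 * v x) =
    (a + b)^-1 * (u x + v x)).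
  by field; rewrite !gt_eqF.
move=> H.
have {}H : fine (E ((a + b)^-1 *: (u + v))) <= 1.
  apply: le_trans (H _) _.
    by move=> x y; rewrite mul1r mul0r addr0; exact: abs_powR_convex.
  nra.
rewrite modular_fin// lee_fin.
have q : (a + b)^-1 `^ p * (a + b) `^ p = 1.
  by rewrite -powRM ?invr_ge0 ?ltW// mulVf ?gt_eqF// powR1.
move: H; rewrite fine_modularZ// gtr0_norm ?invr_gt0// => H.
rewrite -[leLHS]mul1r -q mulrAC -[leRHS]mul1r.
by apply: ler_wpM2r => //; exact: powR_ge0.
Qed.

Lemma modular_norm_uniformly_convex (e : R) : 0 < e -> exists2 C : R, 0 <= C &
  forall u v, modular_dom u -> modular_dom v ->
    modular_norm (u - v) `^ p + C * modular_norm (2^-1 *: (u + v)) `^ p <=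
    (e + C / 2) * (modular_norm u `^ p + modular_norm v `^ p).
Proof.
move=> e0; have [C C0 H] := abs_powR_uniformly_convex p1 e0.
exists C; [exact: C0|move=> u v Wu Wv].
have eC : 0 <= e + C / 2 by rewrite addr_ge0 ?divr_ge0// ltW.
have := @fine_modular_ineq 1 (- 1) 2^-1 2^-1 1 C (e + C / 2) (e + C / 2) _ _
  Wu Wv ler01 C0 eC eC.
rewrite !modular_normK mulrDr mul1r.
have -> : (fun x => 1 * u x + -1 * v x) = u - v.
  by apply/funext => x; rewrite mul1r mulN1r.
have -> : (fun x => 2^-1 * u x + 2^-1 * v x) = 2^-1 *: (u + v).
  by apply/funext => x; rewrite /= -mulrDr.
apply => x y; rewrite !mul1r mulN1r -!mulrDr; exact: H.
Qed.

(** Local control of the L^p norm gives convergence almost everywhere on each piece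
of the exhaustion; lower semicontinuity of the modular along u m - u n, as m
grows, then bounds v - u n. *)
Lemma modular_complete (u : nat -> T -> R) : (forall n, modular_dom (u n)) ->
  (forall n m, (n <= m)%N -> modular_norm (u m - u n) <= 4^-1 ^+ n) ->
  exists2 v, modular_dom v & forall n, modular_norm (v - u n) <= 4^-1 ^+ n.
Proof.
move=> Wu Hu.
have mu_ n : measurable_fun S (u n) by case: (Wu n).
have q0 n : 0 <= 4^-1 ^+ n :> R by rewrite exprn_ge0// invr_ge0.
have Wd w1 w2 : modular_dom w1 -> modular_dom w2 -> modular_dom (w1 - w2).
  by move=> W1 W2; rewrite addrC -scaleN1r; exact: modular_dom_lin.
have Ed n m : (n <= m)%N -> (E (u m - u n)%R <= ((4^-1 ^+ n) `^ p)%:E)%E.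
  by move=> nm; apply/modular_norm_le => //; [exact: Wd|exact: Hu].
have [F [mF Ffin FS FC Fcov]] := pm_exhaustion E.
have cvgF j : {ae mu, forall x, F j x -> cvgn (fun n => u n x)}.
  have [C C0 HC] := FC j.
  apply: (@ae_cvg_fast _ p p1 _ _ mu (F j) u C) => //.
    by move=> n; exact: measurable_funS (FS j) (mu_ n).
  move=> n; apply: (@le_trans _ _ (C%:E * E (u n.+1 - u n)%R)%E).
    by apply: HC; case: (Wd _ _ (Wu n.+1) (Wu n)).
  by rewrite EFinM; apply: lee_wpmul2l; [rewrite lee_fin|exact: Ed].
have cvgS : {ae mu, forall x, S x -> cvgn (fun n => u n x)}.
  have /ae_foralln := cvgF.
  apply: filterS2 Fcov => x cov H Sx.
  by have [j Fj] := cov Sx; exact: H j Fj.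
(* the upper limit is measurable whether or not the sequence converges *)
pose v x := fine (limn_esup (fun n => (u n x)%:E)).
have mv : measurable_fun S v.
  apply: (@measurableT_comp _ _ _ _ _ _ fine _
    (fun x => limn_esup (fun n => (u n x)%:E))) => //.
  by apply: measurable_fun_limn_esup => n; apply/measurable_EFinP.
have uv : {ae mu, forall x, S x -> u n x @[n --> \oo] --> v x}.
  apply: filterS cvgS => x H Sx.
  have /cvg_ex[l ul] := H Sx.
  have eul : (u n x)%:E @[n --> \oo] --> l%:E by apply: cvg_EFin => //; exact: nearW.
  by rewrite /v (is_cvg_limn_esupE (cvgP _ eul)) (cvg_lim _ eul).
have Ev n : (E (v - u n)%R <= ((4^-1 ^+ n) `^ p)%:E)%E.
  apply: (@pm_fatou _ _ _ _ _ _ E (fun m => u (m + n)%N - u n)).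
  - by move=> m; apply: measurable_funB.
  - exact: measurable_funB.
  - apply: filterS uv => x H Sx.
    by apply: cvgB; [rewrite (cvg_shiftn n (fun m => u m x)); exact: H|exact: cvg_cst].
  - by move=> m; apply: Ed; rewrite leq_addl.
have Wvn n : modular_dom (v - u n).
  by split; [exact: measurable_funB|apply: le_lt_trans (Ev n) _; rewrite ltry].
have Wv : modular_dom v.
  by rewrite -[v](subrK (u 0)) -[v - u 0]scale1r; apply: modular_dom_lin.
by exists v => // n; apply/(modular_norm_le (Wvn n) (q0 n)).
Qed.

Definition modular_seminorm : complete_seminorm (T -> R : lmodType R) :=
  CompleteSeminorm modular_dom0 modular_dom_lin modular_normD modular_normZ modular_complete.

End modular_space.

Section modular_quotient.
Context {R : realType} (p : R) (p1 : 1 < p) d (T : measurableType d).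
Variables (mu : {measure set T -> \bar R}) (S : set T) (mS : measurable S).
Variable E : power_modular p mu S.
Implicit Types u v : T -> R.

Let p0 : (0 < p)%R. Proof. exact: lt_trans p1. Qed.

Local Notation N := (modular_seminorm p1 mS E).
Local Notation W := (modular_dom E).
Local Notation Q := (seminorm_quotient N).

Let Wd u v : W u -> W v -> W (u - v).
Proof. by move=> W1 W2; rewrite addrC -scaleN1r; exact: modular_dom_lin. Qed.

Lemma modular_quotient_uniformly_convex : power_uniformly_convex Q p.
Proof.
apply: seminorm_quotient_uniformly_convex => e e0.
exact: (modular_norm_uniformly_convex p1 E e0).
Qed.

Lemma modular_null u : W u ->
  modular_norm E u = 0 <-> {ae mu, forall x, S x -> u x = 0}.
Proof.
move=> Wu; have mSu : measurable_fun S u by case: Wu.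
split.
  move=> u0.
  have Eu : E u = 0%E.
    rewrite (modular_fin Wu) -(modular_normK p1) u0 powR0//.
    by rewrite gt_eqF.
  have [F [mF Ffin FS FC Fcov]] := pm_exhaustion E.
  have z j : {ae mu, forall x, F j x -> (`|u x| `^ p * cst 1 x)%:E = 0%E}.
    have [C C0 /(_ _ mSu)] := FC j; rewrite Eu mule0 => le0.
    have H : power_integral p mu (F j) (cst 1) u = 0%E.
      by apply/eqP; rewrite eq_le le0 power_integral_ge0.
    have m' : measurable_fun (F j) (fun x => (`|u x| `^ p * cst 1 x)%:E).
      by apply: measurable_power => //; exact: measurable_funS (FS j) mSu.
    apply/(ae_eq_integral_abs mu (mF j) m').
    rewrite -[RHS]H; apply: eq_integral => x _.
    by rewrite gee0_abs// lee_fin mulr_ge0 ?powR_ge0//=.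
  apply: filterS2 Fcov (ae_foralln z) => x cov H Sx.
  have [j Fj] := cov Sx; have := H j Fj.
  move=> [] /eqP; rewrite /= mulr1 powR_eq0 normr_eq0.
  by move=> /andP[/eqP].
move=> uae.
have E0 : (E u <= 0)%E.
  apply: (@pm_fatou _ _ _ _ _ _ E (fun=> 0)).
  - by move=> n; exact: measurable_cst.
  - exact: mSu.
  - apply: filterS uae => x H Sx; rewrite H//; exact: cvg_cst.
  - by move=> n; rewrite pm0.
apply/eqP; rewrite eq_le; apply/andP; split; last exact: modular_norm_ge0.
apply/(modular_norm_le p1 Wu (lexx 0)); apply: le_trans E0 _.
by rewrite lee_fin powR_ge0.
Qed.

Lemma modular_class_eq u v : W u -> W v ->
  sn_class N u = sn_class N v <-> {ae mu, forall x, S x -> u x = v x}.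
Proof.
move=> Wu Wv; have Wuv := Wd Wu Wv.
apply: (iff_trans (@sn_class_eq _ _ N u v Wu Wv)).
apply: (iff_trans (modular_null Wuv)).
by split; apply: filterS => x H Sx; [apply/eqP; rewrite -subr_eq0; apply/eqP; exact: H|
  apply/eqP; rewrite subr_eq0; apply/eqP; exact: H].
Qed.

Theorem modular_quotient_reflexive : reflexive_space Q.
Proof. exact: uniformly_convex_reflexive p0 modular_quotient_uniformly_convex. Qed.

(** On the pieces F j of the exhaustion, of finite measure, |u| <= 1 + |u|^p makes the
integrals of u over G n and F j bounded functionals; they separate points because
the G n form a generating pi-system. *)
Theorem modular_quotient_separable (G : nat -> set T) :
  @measurable _ T = <<s range G >> -> setI_closed (range G) -> range G setT ->
  separable_space Q.
Proof.
move=> gG GI GT.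
have mG n : measurable (G n) by rewrite gG; apply: sub_sigma_algebra; exists n.
have [F [mF Ffin FS FC Fcov]] := pm_exhaustion E.
have mpw j u : W u -> measurable_fun (F j) (fun x => (1 + `|u x| `^ p)%:E).
  move=> Wu; apply/measurable_EFinP; apply: measurable_funD; first exact: measurable_cst.
  apply: (measurableT_comp (measurable_powR _)); apply: measurableT_comp => //.
  by apply: measurable_funS (FS j) _ => //; case: Wu.
have bound j : exists2 M : R, 0 <= M & forall u, W u ->
    (\int[mu]_(x in F j) `|(u x)%:E| <= (M * (1 + fine (E u)))%:E)%E.
  have [C C0 HC] := FC j.
  exists (fine (mu (F j)) + C); first by rewrite addr_ge0// fine_ge0.
  move=> u Wu.
  have muu : measurable_fun (F j) u by apply: measurable_funS (FS j) _ => //; case: Wu.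
  have mpu : measurable_fun (F j) (fun x => (`|u x| `^ p * cst 1 x)%:E).
    exact: measurable_power.
  apply: (@le_trans _ _ (\int[mu]_(x in F j) (cst 1 x + (`|u x| `^ p * cst 1 x)%:E))%E).
    apply: ge0_le_integral => //.
    - by apply: measurableT_comp => //; apply/measurable_EFinP.
    - by apply: emeasurable_funD => //; exact: measurable_cst.
    - move=> x _; rewrite /= -EFinD lee_fin mulr1.
      have [h|h] := leP `|u x| 1; first by rewrite ler_wpDr// powR_ge0.
      by rewrite ler_wpDl// le1r_powR// ltW.
  rewrite ge0_integralD//; last by move=> x _; rewrite lee_fin mulr_ge0 ?powR_ge0//=.
  rewrite integral_cst// mul1e.
  have ff : mu (F j) \is a fin_num by rewrite ge0_fin_numE.
  have := HC u (proj1 Wu); rewrite /power_integral (modular_fin Wu) => HC'.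
  apply: le_trans (leeD (lexx _) HC') _.
  rewrite -{1}(fineK ff) -EFinM -EFinD lee_fin.
  have e0 : 0 <= fine (E u) by rewrite fine_ge0// pm_ge0.
  have m0 : 0 <= fine (mu (F j)) by rewrite fine_ge0.
  nra.
have integ j u : W u -> mu.-integrable (F j) (EFin \o u).
  move=> Wu; apply/integrableP; split.
    by apply/measurable_EFinP; apply: measurable_funS (FS j) _ => //; case: Wu.
  have [M M0 HM] := bound j; apply: le_lt_trans (HM u Wu) _; exact: ltry.
pose f n j u : R := (\int[mu]_(x in G n `&` F j) u x)%R.
have integ' n j u : W u -> mu.-integrable (G n `&` F j) (EFin \o u).
  move=> Wu; apply: integrableS (integ j u Wu) => //; exact: measurableI.
have flin n j a u v : W u -> W v -> f n j (a *: u + v) = a * f n j u + f n j v.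
  move=> Wu Wv; rewrite /f.
  have mGF : measurable (G n `&` F j) by exact: measurableI.
  rewrite RintegralD//; last 2 first.
  - apply: integ'; rewrite -[_ *: _]addr0; apply: modular_dom_lin => //.
    exact: modular_dom0.
  - exact: integ'.
  by rewrite RintegralZl//; exact: integ'.
apply: (@seminorm_quotient_separable _ _ N p (nat * nat)%type
  (fun i => f i.1 i.2) p0 modular_quotient_uniformly_convex).
- by move=> [n j] a u v Wu Wv; exact: flin.
- move=> [n j]; have [M M0 HM] := bound j; exists (M * 2) => u Wu Nu.
  have mGF : measurable (G n `&` F j) by exact: measurableI.
  apply: le_trans (le_normr_Rintegral mGF (integ' n j u Wu)) _.
  rewrite -lee_fin /Rintegral fineK; last first.
    have /integrableP[_ h] := integ' n j u Wu.
    by rewrite ge0_fin_numE// integral_ge0.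
  apply: (@le_trans _ _ (\int[mu]_(x in F j) `|(u x)%:E|)%E).
    apply: ge0_subset_integral => //.
    apply: measurableT_comp => //; apply: measurableT_comp => //.
    by apply: measurable_funS (FS j) _ => //; case: Wu.
  apply: le_trans (HM u Wu) _; rewrite lee_fin ler_wpM2l//.
  have : fine (E u) <= 1.
    rewrite -(modular_normK p1) -[leRHS](one_powR p).
    by apply: (powR_homo_le p0); [exact: modular_norm_ge0|exact: Nu].
  lra.
- move=> u Wu H; apply/(modular_null Wu).
  have z j : {ae mu, forall x, F j x -> (u x)%:E = 0%E}.
    apply: (@ae_zero_of_pi_system _ _ _ mu (range G)) => //; first exact: integ.
    move=> _ [n _ <-]; have /= h := H (n, j).
    have fn : (\int[mu]_(x in G n `&` F j) (u x)%:E)%E \is a fin_num.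
      exact: (integrable_fin_num (measurableI _ _ (mG n) (mF j)) (integ' n j u Wu)).
    by rewrite -(fineK fn) -[fine _]/(f n j u) h.
  apply: filterS2 Fcov (ae_foralln z) => t cov Ht St.
  by have [j Fj] := cov St; have [] := Ht j Fj.
Qed.

End modular_quotient.

(** * The nonlocal energy of a nonnegative kernel *)

Section product_null_sets.
Context {R : realType} d1 d2 (T1 : measurableType d1) (T2 : measurableType d2).
Variables (m1 : {sigma_finite_measure set T1 -> \bar R})
  (m2 : {sigma_finite_measure set T2 -> \bar R}).
Local Open Scope ereal_scope.

Lemma ae_prod_fst (P : T1 -> Prop) : {ae m1, forall x, P x} ->
  {ae (m1 \x m2), forall z, P z.1}.
Proof.
move=> [N [mN N0 PN]]; exists (N `*` setT); split.
- exact: measurableX.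
- transitivity (m1 N * m2 setT); first exact: product_measure1E.
  by rewrite N0 mul0e.
- by move=> z /= nP; split => //; apply: PN.
Qed.

Lemma ae_prod_snd (P : T2 -> Prop) : {ae m2, forall x, P x} ->
  {ae (m1 \x m2), forall z, P z.2}.
Proof.
move=> [N [mN N0 PN]]; exists (setT `*` N); split.
- exact: measurableX.
- transitivity (m1 setT * m2 N); first exact: product_measure1E.
  by rewrite N0 mule0.
- by move=> z /= nP; split => //; apply: PN.
Qed.

Lemma integral_prod_iterated (A : set T1) (B : set T2) (f : T1 * T2 -> \bar R) :
  measurable A -> measurable B -> measurable_fun (A `*` B) f ->
  (forall z, (A `*` B) z -> 0 <= f z) ->
  (\int[m1 \x m2]_(z in A `*` B) f z =
     \int[m1]_(x in A) \int[m2]_(y in B) f (x, y)) /\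
  (\int[m1 \x m2]_(z in A `*` B) f z =
     \int[m2]_(y in B) \int[m1]_(x in A) f (x, y)).
Proof.
move=> mA mB mf f0.
have mAB : measurable (A `*` B) by exact: measurableX.
pose g := f \_ (A `*` B).
have mg : measurable_fun setT g by exact/(measurable_restrictT _ mAB).
have g0 z : 0 <= g z by apply: erestrict_ge0 => x; exact: f0.
rewrite integral_mkcond -/g; split.
  rewrite fubini_tonelli1// [RHS]integral_mkcond; apply: eq_integral => x _.
  rewrite /fubini_F patchE; case: ifPn => [/set_mem xA|/negP xA].
    rewrite [RHS]integral_mkcond; apply: eq_integral => y _.
    rewrite /g !patchE; have -> // : ((x, y) \in A `*` B) = (y \in B).
    by apply/idP/idP => /set_mem => [[_ h]|h]; exact/mem_set.
  rewrite integral0_eq// => y _; rewrite /g patchE ifF//.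
  by apply/negbTE/negP => /set_mem [h _]; apply: xA; exact/mem_set.
rewrite fubini_tonelli2// [RHS]integral_mkcond; apply: eq_integral => y _.
rewrite /fubini_G patchE; case: ifPn => [/set_mem yB|/negP yB].
  rewrite [RHS]integral_mkcond; apply: eq_integral => x _.
  rewrite /g !patchE; have -> // : ((x, y) \in A `*` B) = (x \in A).
  by apply/idP/idP => /set_mem => [[h _]|h]; exact/mem_set.
rewrite integral0_eq// => x _; rewrite /g patchE ifF//.
by apply/negbTE/negP => /set_mem [_ h]; apply: yB; exact/mem_set.
Qed.

Lemma measurable_fun_integral_fst (A : set T1) (f : T1 * T2 -> \bar R) :
  measurable A -> measurable_fun setT f -> (forall z, 0 <= f z) ->
  measurable_fun setT (fun y => \int[m1]_(x in A) f (x, y)).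
Proof.
move=> mA mf f0; pose g := f \_ (A `*` setT).
have mAT : measurable (A `*` [set: T2]) by exact: measurableX.
have mg : measurable_fun setT g.
  by apply/(measurable_restrictT _ mAT); exact: measurable_funTS.
have g0 z : 0 <= g z by apply: erestrict_ge0 => x _; exact: f0.
rewrite (_ : (fun y => _) = fubini_G m1 g).
  exact: measurable_fun_fubini_tonelli_G.
apply/funext => y; rewrite /fubini_G [LHS]integral_mkcond.
apply: eq_integral => x _; rewrite /g !patchE.
have -> // : ((x, y) \in A `*` setT) = (x \in A).
by apply/idP/idP => /set_mem => [[h _]|h]; exact/mem_set.
Qed.

End product_null_sets.

Section energy.
Context {R : realType} (p : R) (p1 : 1 < p) d (T : measurableType d).
Variable mu : {sigma_finite_measure set T -> \bar R}.
Variables (Om D : set T) (mOm : measurable Om) (mD : measurable D).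
Variable k : T * T -> R.
Hypotheses (k0 : forall z, 0 <= k z) (mk : measurable_fun setT k).
Implicit Types u v : T -> R.
Local Open Scope ereal_scope.

Let p0 : (0 < p)%R. Proof. exact: lt_trans p1. Qed.

Local Notation S := (Om `|` D).

(** The double integral is taken on the product space, where Fatou's lemma and the
integration of pointwise inequalities apply in one step. *)
Definition energy u : \bar R :=
  power_integral p mu Om (cst 1%R) u +
  power_integral p (mu \x mu) (Om `*` D) k (fun z => (u z.1 - u z.2)%R).

Let mOD : measurable (Om `*` D). Proof. exact: measurableX. Qed.

Let mk' : measurable_fun (Om `*` D) k. Proof. exact: measurable_funTS. Qed.

Let mS : measurable S. Proof. exact: measurableU. Qed.

Let mO u : measurable_fun S u -> measurable_fun Om u.
Proof. by apply: measurable_funS => //; exact: subsetUl. Qed.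

Let mdiff u : measurable_fun S u ->
  measurable_fun (Om `*` D) (fun z => (u z.1 - u z.2)%R).
Proof.
move=> mu_; apply: measurable_funB.
  apply: (@measurable_comp _ _ _ _ _ _ S u _ fst) => //.
    by move=> _ [z [h _] <-]; left.
  exact: measurable_funTS measurable_fst.
apply: (@measurable_comp _ _ _ _ _ _ S u _ snd) => //.
  by move=> _ [z [_ h] <-]; right.
exact: measurable_funTS measurable_snd.
Qed.

Lemma energy_ge0 u : 0 <= energy u.
Proof. by apply: adde_ge0; apply: power_integral_ge0 => // *; exact: ler01. Qed.

Lemma energy0 : energy 0%R = 0.
Proof.
rewrite /energy /power_integral !integral0_eq ?adde0//.
  by move=> z _; rewrite subrr normr0 powR0 ?mul0r// gt_eqF.
by move=> z _; rewrite normr0 powR0 ?mul0r// gt_eqF.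
Qed.

Lemma energy_ineq (a1 b1 a2 b2 c1 c2 c3 c4 : R) u v :
  measurable_fun S u -> measurable_fun S v ->
  (0 <= c1)%R -> (0 <= c2)%R -> (0 <= c3)%R -> (0 <= c4)%R ->
  (forall a b : R, c1 * `|a1 * a + b1 * b| `^ p + c2 * `|a2 * a + b2 * b| `^ p <=
    c3 * `|a| `^ p + c4 * `|b| `^ p)%R ->
  c1%:E * energy (fun x => a1 * u x + b1 * v x)%R +
  c2%:E * energy (fun x => a2 * u x + b2 * v x)%R <=
  c3%:E * energy u + c4%:E * energy v.
Proof.
move=> mu_ mv c10 c20 c30 c40 H.
have mc (a b : R) : measurable_fun S (fun x => a * u x + b * v x)%R.
  by apply: measurable_funD; apply: measurable_funM => //; exact: measurable_cst.
have dist (c : R) f : c%:E * energy f = c%:E * power_integral p mu Om (cst 1%R) f +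
    c%:E * power_integral p (mu \x mu) (Om `*` D) k (fun z => (f z.1 - f z.2)%R).
  by rewrite /energy ge0_muleDr//; apply: power_integral_ge0 => // *; exact: ler01.
rewrite (dist c1) (dist c2) (dist c3) (dist c4) addeACA [leRHS]addeACA.
apply: leeD.
  by apply: power_integral_ineq; rewrite ?lee01//; do ?exact: mO; do ?exact: mc.
have E (a b : R) : power_integral p (mu \x mu) (Om `*` D) k
    (fun z => (a * u z.1 + b * v z.1 - (a * u z.2 + b * v z.2))%R) =
  power_integral p (mu \x mu) (Om `*` D) k
    (fun z => (a * (u z.1 - u z.2) + b * (v z.1 - v z.2))%R).
  by apply: eq_power_integral => z _; ring.
rewrite !E; apply: power_integral_ineq => //; do ?exact: mdiff.
- by apply: measurable_funD; (apply: measurable_funM; [exact: measurable_cst|exact: mdiff]).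
- by apply: measurable_funD; (apply: measurable_funM; [exact: measurable_cst|exact: mdiff]).
Qed.

Lemma energy_fatou (u : nat -> T -> R) v (c : \bar R) :
  (forall n, measurable_fun S (u n)) -> measurable_fun S v ->
  {ae mu, forall x, S x -> u n x @[n --> \oo] --> v x} ->
  (forall n, energy (u n) <= c) -> energy v <= c.
Proof.
move=> mu_ mv uv uc.
pose a n := power_integral p mu Om (cst 1%R) (u n).
pose b n := power_integral p (mu \x mu) (Om `*` D) k (fun z => (u n z.1 - u n z.2)%R).
apply: (@le_trans _ _ (limn_einf a + limn_einf b)); last first.
  by apply: limn_einfD_le => n;
    [exact: power_integral_ge0|exact: power_integral_ge0|exact: uc].
apply: leeD.
  apply: power_integral_fatou => //; do ?exact: mO.
    by move=> n; exact: mO.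
  by apply: filterS uv => x h Ox; apply: h; left.
apply: power_integral_fatou => //.
- by move=> n; exact: mdiff.
- exact: mdiff.
have uv1 := ae_prod_fst mu uv; have uv2 := ae_prod_snd mu uv.
apply: filterS2 uv1 uv2 => z h1 h2 [Oz Dz].
by apply: cvgB; [apply: h1; left|apply: h2; right].
Qed.

Definition interaction_weight y : \bar R :=
  \int[mu]_(x in Om) (Num.min 1%R (k (x, y)))%:E.

Let min_ge0 z : (0 <= Num.min 1 (k z))%R.
Proof. by rewrite le_min ler01 k0. Qed.

Let mmin : measurable_fun setT (fun z => (Num.min 1%R (k z))%:E).
Proof. by apply/measurable_EFinP; exact: measurable_minr. Qed.

Lemma measurable_interaction_weight : measurable_fun setT interaction_weight.
Proof.
apply: (measurable_fun_integral_fst mu (f := fun z => (Num.min 1%R (k z))%:E)) => // z.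
Qed.

(** Tonelli's theorem turns the weighted integral of |u(y)|^p into a double integral,
in which |u(y)|^p min(1, k) <= 2^p (|u(x)|^p + |u(x) - u(y)|^p k). The first
term does not depend on y and contributes the measure of B. *)
Lemma energy_controls_power u (B : set T) (c : R) : measurable_fun S u ->
  measurable B -> B `<=` D -> mu B < +oo -> (0 < c)%R ->
  (forall y, B y -> c%:E <= interaction_weight y) ->
  power_integral p mu B (cst 1%R) u <=
    (c^-1 * (2 `^ p * (fine (mu B) + 1)))%:E * energy u.
Proof.
move=> mu_ mB BD Bfin c0 cB.
have mBu : measurable_fun B u by apply: measurable_funS mu_ => // x /BD; right.
have mpw (A : set T) (f : T -> R) : measurable_fun A f ->
    measurable_fun A (fun x => (`|f x| `^ p)%:E).
  move=> mf; apply/measurable_EFinP; apply: (measurableT_comp (measurable_powR _)).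
  exact: measurableT_comp.
have mOB : measurable (Om `*` B) by exact: measurableX.
have sOB : Om `*` B `<=` Om `*` D by move=> z [? /BD].
have muT : measurable_fun (Om `*` B) (fun z => (`|u z.2|)%R).
  apply: measurableT_comp => //.
  apply: (@measurable_comp _ _ _ _ _ _ S u _ snd) => //.
    by move=> _ [z [_ /BD h] <-]; right.
  exact: measurable_funTS measurable_snd.
have muT1 : measurable_fun (Om `*` B) (fun z => (`|u z.1|)%R).
  apply: measurableT_comp => //.
  apply: (@measurable_comp _ _ _ _ _ _ S u _ fst) => //.
    by move=> _ [z [h _] <-]; left.
  exact: measurable_funTS measurable_fst.
have m1 : measurable_fun (Om `*` B) (fun z => (`|u z.2| `^ p * Num.min 1%R (k z))%:E).
  apply/measurable_EFinP; apply: measurable_funM.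
    exact: (measurableT_comp (measurable_powR _)).
  by apply: measurable_funTS; exact: measurable_minr.
have m2 : measurable_fun (Om `*` B) (fun z => (`|u z.1| `^ p)%:E).
  by apply/measurable_EFinP; exact: (measurableT_comp (measurable_powR _)).
have m3 : measurable_fun (Om `*` B) (fun z => (`|u z.1 - u z.2| `^ p * k z)%:E).
  apply: measurable_power; first exact: measurable_funTS.
  exact: (measurable_funS mOD sOB (mdiff mu_)).
have step1 : c%:E * power_integral p mu B (cst 1%R) u <=
    \int[mu \x mu]_(z in Om `*` B) (`|u z.2| `^ p * Num.min 1%R (k z))%:E.
  rewrite (integral_prod_iterated mu mu mOm mB m1 _).2; last first.
    by move=> z _; rewrite lee_fin mulr_ge0 ?powR_ge0.
  rewrite /power_integral -ge0_integralZl_EFin//; last 3 first.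
  - by move=> y _; rewrite lee_fin mulr1 powR_ge0.
  - by under eq_fun do rewrite mulr1; exact: mpw.
  - exact: ltW.
  have e y : B y -> \int[mu]_(x in Om) (`|u y| `^ p * Num.min 1%R (k (x, y)))%:E =
      (`|u y| `^ p)%:E * interaction_weight y.
    move=> By; under eq_integral do rewrite EFinM.
    rewrite ge0_integralZl_EFin ?powR_ge0//.
    - by move=> x _; rewrite lee_fin.
    - apply: measurable_funTS.
      exact: (measurableT_comp mmin (measurable_pair2 y)).
  apply: ge0_le_integral => //.
  - by move=> y _; rewrite -EFinM lee_fin mulr1 mulr_ge0 ?powR_ge0// ltW.
  - by apply: measurable_funeM; under eq_fun do rewrite mulr1; exact: mpw.
  - apply: eq_measurable_fun.
      by move=> y /set_mem By; rewrite /= e//; exact: erefl.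
    apply: emeasurable_funM; first exact: mpw.
    exact: measurable_funTS measurable_interaction_weight.
  - move=> y By; rewrite /= e// mulr1 muleC; apply: lee_wpmul2l; last exact: cB.
    by rewrite lee_fin powR_ge0.
have step2 : \int[mu \x mu]_(z in Om `*` B) (`|u z.2| `^ p * Num.min 1%R (k z))%:E <=
   \int[mu \x mu]_(z in Om `*` B)
     ((2 `^ p)%:E * ((`|u z.1| `^ p)%:E + (`|u z.1 - u z.2| `^ p * k z)%:E)).
  apply: ge0_le_integral => //.
  - by move=> z _; rewrite lee_fin mulr_ge0 ?powR_ge0.
  - by apply: measurable_funeM; exact: emeasurable_funD.
  move=> z _; rewrite -EFinD -EFinM lee_fin.
  apply: (@le_trans _ _ ((2 `^ p * (`|u z.1| `^ p + `|u z.1 - u z.2| `^ p)) *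
    Num.min 1 (k z))%R).
    by apply: ler_wpM2r => //; exact: powR_triangle_le.
  rewrite -mulrA; apply: ler_wpM2l; first exact: powR_ge0.
  rewrite mulrDl; apply: lerD.
    by rewrite ler_piMr ?powR_ge0// ge_min lexx.
  by apply: ler_wpM2l; [exact: powR_ge0|rewrite ge_min lexx orbT].
have fB : mu B \is a fin_num by rewrite ge0_fin_numE.
have step3 : \int[mu \x mu]_(z in Om `*` B)
     ((2 `^ p)%:E * ((`|u z.1| `^ p)%:E + (`|u z.1 - u z.2| `^ p * k z)%:E)) <=
   (2 `^ p * (fine (mu B) + 1))%:E * energy u.
  rewrite ge0_integralZl_EFin//; last 2 first.
  - by move=> z _; rewrite adde_ge0// lee_fin ?mulr_ge0 ?powR_ge0.
  - exact: emeasurable_funD.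
  rewrite EFinM -muleA; apply: lee_wpmul2l; first by rewrite lee_fin powR_ge0.
  rewrite ge0_integralD//; last by move=> z _; rewrite lee_fin mulr_ge0 ?powR_ge0.
  rewrite (integral_prod_iterated mu mu mOm mB m2 _).1; last first.
    by move=> z _; rewrite lee_fin powR_ge0.
  have -> : \int[mu]_(x in Om) \int[mu]_(y in B) (`|u x| `^ p)%:E =
      mu B * power_integral p mu Om (cst 1%R) u.
    under eq_integral do rewrite integral_cst//.
    rewrite -(fineK fB) /power_integral -ge0_integralZl_EFin ?fine_ge0//.
    - by apply: eq_integral => x _; rewrite fineK// muleC /= mulr1.
    - by move=> x _; rewrite lee_fin mulr1 powR_ge0.
    - by under eq_fun do rewrite mulr1; exact/mpw/mO.
  have M1 : 0 <= power_integral p mu Om (cst 1%R) u.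
    by apply: power_integral_ge0 => // *; exact: ler01.
  have M2 : 0 <= power_integral p (mu \x mu) (Om `*` D) k (fun z => (u z.1 - u z.2)%R).
    exact: power_integral_ge0.
  rewrite EFinD fineK// ge0_muleDl// mul1e; apply: leeD.
    by apply: lee_wpmul2l => //; rewrite /energy leeDl.
  apply: (@le_trans _ _ (power_integral p (mu \x mu) (Om `*` D) k
    (fun z => (u z.1 - u z.2)%R))); last by rewrite /energy leeDr.
  apply: ge0_subset_integral => //.
    by apply: measurable_power => //; exact: mdiff.
  by move=> z _; rewrite lee_fin mulr_ge0 ?powR_ge0.
rewrite EFinM -muleA.
rewrite -[leLHS]mul1e -[1%E](_ : (c^-1)%:E * c%:E = 1); last first.
  by rewrite -EFinM mulVf// gt_eqF.
rewrite -muleA; apply: lee_wpmul2l; first by rewrite lee_fin invr_ge0 ltW.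
exact: (le_trans step1 (le_trans step2 step3)).
Qed.

Local Open Scope ring_scope.
(** On Omega the energy contains the L^p norm; outside Omega the pieces are the sets
where the weight is at least 1/(n + 1). *)
Lemma energy_exhaustion :
  {ae mu, forall y, (D `\` Om) y -> (0 < interaction_weight y)%E} ->
  exists F : nat -> set T,
  [/\ forall n, measurable (F n), forall n, (mu (F n) < +oo)%E,
      forall n, F n `<=` S,
      forall n, exists2 C, 0 <= C & forall u, measurable_fun S u ->
        (power_integral p mu (F n) (cst 1%R) u <= C%:E * energy u)%E &
      {ae mu, forall x, S x -> exists n, F n x}].
Proof.
move=> weight_gt0; have [G [GT ndG Gfin]] := (sigma_finiteP setT mu).1 (sigma_finiteT mu).
pose B n := (D `\` Om) `&` (G n `&` [set y | ((n.+1%:R^-1)%:E <= interaction_weight y)%E]).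
have mB n : measurable (B n).
  apply: measurableI; first exact: measurableD.
  apply: measurableI; first by have [] := Gfin n.
  rewrite -[X in measurable X]setTI; apply: emeasurable_fun_c_infty => //.
  exact: measurable_interaction_weight.
have mGO n : measurable (Om `&` G n) by apply: measurableI => //; have [] := Gfin n.
have le_G n (A : set T) : measurable A -> A `<=` G n -> (mu A < +oo)%E.
  move=> mA AG; have [mG Gf] := Gfin n.
  by apply: le_lt_trans Gf; apply: le_measure => //; rewrite inE.
exists (fun n => (Om `&` G n) `|` B n); split.
- by move=> n; exact: measurableU.
- move=> n; apply: (le_G n); first exact: measurableU.
  by move=> x [[]|[_ []]].
- by move=> n x [[? _]|[[? _] _]]; [left|right].
- move=> n; pose c : R := n.+1%:R^-1.
  exists (1 + c^-1 * (2 `^ p * (fine (mu (B n)) + 1))).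
    rewrite addr_ge0// !mulr_ge0 ?powR_ge0// ?invr_ge0 ?addr_ge0//.
    exact: fine_ge0.
  move=> u mu_; rewrite /power_integral ge0_integral_setU//; last 3 first.
  - apply/measurable_EFinP; under eq_fun do rewrite mulr1.
    apply: (measurableT_comp (measurable_powR _)); apply: measurableT_comp => //.
    by apply: measurable_funS mu_ => // x [[? _]|[[? _] _]]; [left|right].
  - by move=> x _; rewrite lee_fin mulr1 powR_ge0.
  - by apply/disj_setPS => x [[? _] [[_ ?] _]].
  rewrite EFinD ge0_muleDl//; last first.
    rewrite lee_fin !mulr_ge0 ?powR_ge0// ?invr_ge0 ?addr_ge0//.
    exact: fine_ge0.
  rewrite mul1e; apply: leeD.
    apply: (@le_trans _ _ (power_integral p mu Om (cst 1%R) u)).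
      apply: ge0_subset_integral => //.
      - apply/measurable_EFinP; under eq_fun do rewrite mulr1.
        apply: (measurableT_comp (measurable_powR _)); apply: measurableT_comp => //.
        by apply: measurable_funS mu_ => // x; left.
      - by move=> x _; rewrite lee_fin mulr1 powR_ge0.
    by rewrite leeDl//; apply: power_integral_ge0.
  apply: energy_controls_power => //.
  - by move=> x [[]].
  - by apply: (le_G n) => // x [_ []].
  - by rewrite invr_gt0.
  - by move=> y [_ [_]].
apply: filterS weight_gt0 => x wx Sx.
have [n _ Gn] : (\bigcup_n G n) x by rewrite -GT.
have [Ox|nOx] := pselect (Om x); first by exists n; left.
have Dx : (D `\` Om) x by case: Sx => // Dx; split.
have [r r0 rw] : exists2 r : R, 0 < r & (r%:E <= interaction_weight x)%E.
  have := wx Dx; case: (interaction_weight x) => [r|_|//].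
    by rewrite lte_fin; exists r.
  by exists 1; rewrite ?ltr01// leey.
have [j jr] := ltr_add_invr r0; rewrite add0r in jr.
exists (maxn n j); right; split => //; split.
  by move: Gn; apply/subsetPset/ndG/leq_maxl.
apply: le_trans rw; rewrite lee_fin; apply: le_trans (ltW jr).
by rewrite lef_pV2 ?posrE// ler_nat ltnS leq_maxr.
Qed.

End energy.

Section energy_modular.
Context {R : realType} (p : R) (p1 : 1 < p) d (T : measurableType d).
Variable mu : {sigma_finite_measure set T -> \bar R}.
Variables (Om D : set T) (mOm : measurable Om) (mD : measurable D).
Variable k : T * T -> R.
Hypotheses (k0 : forall z, 0 <= k z) (mk : measurable_fun setT k).
Hypothesis weight_gt0 :
  {ae mu, forall y, (D `\` Om) y -> (0 < interaction_weight mu Om k y)%E}.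

Definition energy_modular : power_modular p mu (Om `|` D) :=
  PowerModular (energy_ge0 p mu Om D k0) (energy0 p1 mu Om D k)
    (energy_ineq mu mOm mD k0 mk) (energy_fatou p1 mOm mD k0 mk)
    (energy_exhaustion p1 mOm mD k0 mk weight_gt0).

End energy_modular.

(** * Lebesgue measure on the row vectors *)

Section rational_boxes.
Context {R : realType} (d : nat).
Notation E := 'rV[R]_d.

Definition rat_box (c : 'rV[rat]_d * 'rV[rat]_d) : set E :=
  [set v | forall i, ratr (c.1 ord0 i) < v ord0 i < ratr (c.2 ord0 i)].

Lemma measurable_rat_box c : measurable (rat_box c).
Proof.
rewrite (_ : rat_box c = \bigcap_(i in [set: 'I_d])
    ((fun v : E => v ord0 i : measurableTypeR R) @^-1`
      `]ratr (c.1 ord0 i), ratr (c.2 ord0 i)[)).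
  apply: fin_bigcap_measurable => //= i _.
  by rewrite -[X in measurable X]setTI; apply: measurable_rV_coord.
apply/seteqP; split => v /= h i.
  by move=> _ /=; rewrite in_itv/=; exact: h.
by have := h i I; rewrite /= in_itv.
Qed.

Lemma rat_box_nbhs (O : set E) v : open O -> O v ->
  exists2 c, rat_box c v & rat_box c `<=` O.
Proof.
move=> oO Ov; have : nbhs v O by exact: open_nbhs_nbhs.
rewrite -nbhs_ballE => -[e /= e0 eO].
have lo i : exists q : rat, v ord0 i - e < ratr q < v ord0 i.
  have : v ord0 i - e < v ord0 i by rewrite ltrBlDr ltrDl.
  by move=> /rat_in_itvoo[q]; rewrite in_itv/=; exists q.
have hi i : exists q : rat, v ord0 i < ratr q < v ord0 i + e.
  have : v ord0 i < v ord0 i + e by rewrite ltrDl.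
  by move=> /rat_in_itvoo[q]; rewrite in_itv/=; exists q.
exists (\row_i sval (cid (lo i)), \row_i sval (cid (hi i))).
  move=> i; rewrite !mxE; case: cid => a /= /andP[_ ->]; case: cid => b /= /andP[-> _].
  by [].
move=> w bw; apply: eO; split => // i j; rewrite (ord1 i).
have := bw j; rewrite !mxE; case: cid => a /= /andP[h1 h2]; case: cid => b /= /andP[h3 h4].
move=> /andP[h5 h6]; rewrite /ball /= ltr_norml; apply/andP; split; lra.
Qed.

(** The whole space is added to the rational boxes, so that they form a pi-system
containing it. *)
Definition box_system (n : nat) : set E :=
  if unpickle n is Some (Some c) then rat_box c else setT.

Lemma box_systemE (c : 'rV[rat]_d * 'rV[rat]_d) :
  box_system (pickle (Some c)) = rat_box c.
Proof. by rewrite /box_system pickleK. Qed.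

Lemma box_systemT : range box_system setT.
Proof.
by exists (pickle (None : option ('rV[rat]_d * 'rV[rat]_d))); rewrite // /box_system pickleK.
Qed.

Lemma box_system_cases A : range box_system A -> A = setT \/ exists c, A = rat_box c.
Proof.
move=> [n _ <-]; rewrite /box_system; case: unpickle => [[c|]|]; [|by left..].
by right; exists c.
Qed.

Lemma box_system_box c : range box_system (rat_box c).
Proof. by exists (pickle (Some c)) => //; rewrite box_systemE. Qed.

Lemma box_system_setI : setI_closed (range box_system).
Proof.
move=> A B /box_system_cases[->|[c ->]] /box_system_cases[->|[c' ->]].
- by rewrite setTI; exact: box_systemT.
- by rewrite setTI; exact: box_system_box.
- by rewrite setIT; exact: box_system_box.
rewrite (_ : _ `&` _ = rat_box (\row_i Num.max (c.1 ord0 i) (c'.1 ord0 i),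
    \row_i Num.min (c.2 ord0 i) (c'.2 ord0 i))); first exact: box_system_box.
have maxE (a b : rat) : ratr (Num.max a b) = Num.max (ratr a) (ratr b) :> R.
  by rewrite !maxEle ler_rat; case: ifP.
have minE (a b : rat) : ratr (Num.min a b) = Num.min (ratr a) (ratr b) :> R.
  by rewrite !minEle ler_rat; case: ifP.
apply/seteqP; split => v.
  move=> [h h'] i; rewrite !mxE maxE minE gt_max lt_min.
  by have /andP[-> ->] := h i; have /andP[-> ->] := h' i.
move=> h; split => i; have := h i; rewrite !mxE maxE minE gt_max lt_min;
  by move=> /andP[/andP[? ?] /andP[? ?]]; apply/andP.
Qed.

Lemma open_bigcup_rat_box (O : set E) : open O ->
  O = \bigcup_(n in [set n | box_system n `<=` O]) box_system n.
Proof.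
move=> oO; apply/seteqP; split => v; last by move=> [n nO /nO].
move=> Ov; have [c cv cO] := rat_box_nbhs oO Ov.
by exists (pickle (Some c)); rewrite /= box_systemE.
Qed.

Lemma measurable_box_system n : measurable (box_system n).
Proof.
rewrite /box_system; case: unpickle => [[c|]|]; by [|exact: measurable_rat_box].
Qed.

Lemma open_measurable_rV (O : set E) : open O -> measurable O.
Proof.
move=> /open_bigcup_rat_box ->; apply: bigcup_measurable => n _.
exact: measurable_box_system.
Qed.

(** A half-space on one coordinate is open, hence a countable union of rational boxes. *)
Lemma measurable_box_systemE : @measurable _ E = <<s range box_system >>.
Proof.
apply/seteqP; split; last first.
  apply: smallest_sub; first exact: sigma_algebra_measurable.
  by move=> _ [n _ <-]; exact: measurable_box_system.
apply: smallest_sub; first exact: smallest_sigma_algebra.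
rewrite -bigcup_seq => A [i _] /= [B mB <-]; rewrite setTI.
rewrite RGenOInfty.measurableE in mB.
pose sigmaE := g_sigma_algebraType (range box_system).
have smB := smallest_sub _ _ mB.
apply: (smB (fun B => @measurable _ sigmaE ((fun v : E => v ord0 i : R) @^-1` B))).
  split => [|C mC|C mC].
  - by rewrite preimage_set0; exact: measurable0.
  - by rewrite setTD preimage_setC; exact: measurableC.
  - by rewrite preimage_bigcup; exact: bigcupT_measurable.
move=> _ [x ->].
have /open_bigcup_rat_box -> : open ((fun v : E => v ord0 i : R) @^-1` `]x, +oo[).
  by apply: open_comp; [move=> v _; exact: coord_continuous|exact: interval_open].
apply: (@bigcup_measurable _ (g_sigma_algebraType (range box_system))) => n _.
by apply: sub_sigma_algebra; exists n.
Qed.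

End rational_boxes.

Section lebesgue_reflection.
Context {R : realType} (d : nat).
Notation E := 'rV[R]_d.

Lemma measurable_rV_sub : measurable_fun setT (fun z : E * E => z.1 - z.2).
Proof.
apply: measurable_fun_rVP => i.
rewrite (_ : (fun _ => _) = (fun z : E * E => (z.1 ord0 i : R) - z.2 ord0 i)).
  apply: measurable_funB.
    exact: (measurableT_comp (measurable_rV_coord i) measurable_fst).
  exact: (measurableT_comp (measurable_rV_coord i) measurable_snd).
by apply/funext => z; rewrite !mxE.
Qed.

Lemma measurable_reflection (x : E) : measurable_fun setT (fun y : E => x - y).
Proof. exact: (measurableT_comp measurable_rV_sub (measurable_pair1 x)). Qed.

Lemma leb_itv_box (a b : 'I_d -> R) :
  leb d [set v : E | forall i, a i < v ord0 i < b i] =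
  (\prod_(i < d) (if (a i < b i)%R then (b i - a i)%:E else 0))%E.
Proof.
have := @leb_box R d (fun i => `]a i, b i[%classic).
rewrite (_ : [set v : E | forall i, a i < v ord0 i < b i] =
    [set v : E | forall i, `]a i, b i[%classic (v ord0 i)]); last first.
  by apply/seteqP; split => v /= h i; have := h i; rewrite /= in_itv.
move=> ->; last by move=> i; exact: measurable_itv.
by apply: eq_bigr => i _; rewrite lebesgue_measure_itv/= lte_fin EFinB.
Qed.

(** The reflected measure agrees with Lebesgue measure on rational boxes, and these
generate the Borel sets. *)
Lemma leb_reflection (x : E) (A : set E) : measurable A ->
  leb d ((fun y : E => x - y) @^-1` A) = leb d A.
Proof.
rewrite measurable_box_systemE => mA; rewrite -[LHS]/(pushforward (leb d) _ A).
pose g (n : nat) : set E := rat_box (const_mx (- n%:R), const_mx n%:R).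
have gfin n : (leb d (g n) < +oo)%E.
  rewrite (leb_itv_box (fun i => ratr ((const_mx (- n%:R) : 'rV[rat]_d) ord0 i))
    (fun i => ratr ((const_mx n%:R : 'rV[rat]_d) ord0 i))).
  rewrite -ge0_fin_numE; last first.
    apply: prode_ge0 => i _; case: ifP => // h; rewrite lee_fin subr_ge0; exact: ltW.
  by apply: prode_fin_num => i _; case: ifP.
apply/esym; move: A mA.
apply: (@g_sigma_algebra_measure_unique _ R E (range (@box_system R d)) _ g).
- by move=> _ [n _ <-]; exact: measurable_box_system.
- by move=> n; exact: box_system_box.
- apply/seteqP; split => // v _.
  have [n nv] : exists n : nat, forall i, `|v ord0 i| < n%:R.
    exists (\sum_(i < d) (Num.truncn `|v ord0 i|).+1)%N => i.
    apply: (@lt_le_trans _ _ (Num.truncn `|v ord0 i|).+1%:R); first exact: truncnS_gt.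
    by rewrite ler_nat (bigD1 i)//= leq_addr.
  exists n => //= i; rewrite !mxE rmorphN/= ratr_nat.
  by have := nv i; rewrite ltr_norml.
- exact: measurable_reflection.
- exact: box_system_setI.
- move=> mrefl A /box_system_cases[->|[c ->]]; first by rewrite /= /pushforward preimage_setT.
  rewrite /= /pushforward.
  have -> : (fun y : E => x - y) @^-1` rat_box c = [set v : E | forall i,
      x ord0 i - ratr (c.2 ord0 i) < v ord0 i < x ord0 i - ratr (c.1 ord0 i)].
    apply/seteqP; split => v /= h i; have := h i; rewrite !mxE => /andP[h1 h2].
      by apply/andP; split; lra.
    by apply/andP; split; lra.
  rewrite (leb_itv_box (fun i => ratr (c.1 ord0 i)) (fun i => ratr (c.2 ord0 i))).
  rewrite [RHS]leb_itv_box.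
  apply: eq_bigr => i _.
  rewrite (_ : (x ord0 i - ratr (c.2 ord0 i) < x ord0 i - ratr (c.1 ord0 i)) =
    (ratr (c.1 ord0 i) < ratr (c.2 ord0 i) :> R)); last by rewrite ltrD2l ltrN2.
  by case: ifP => // _; congr EFin; ring.
- exact: gfin.
Qed.

Lemma ae_reflection (x : E) (P : E -> Prop) : {ae leb d, forall h, P h} ->
  {ae leb d, forall y, P (x - y)}.
Proof.
move=> [N [mN N0 PN]]; exists ((fun y : E => x - y) @^-1` N); split.
- by rewrite -[X in measurable X]setTI; exact: measurable_reflection.
- by rewrite leb_reflection.
- by move=> y /= nP; exact: PN.
Qed.

Lemma leb_open_gt0 (O : set E) : open O -> O !=set0 -> (0 < leb d O)%E.
Proof.
move=> oO [v Ov]; have [c cv cO] := rat_box_nbhs oO Ov.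
apply: (@lt_le_trans _ _ (leb d (rat_box c))); last first.
  apply: le_measure => //; rewrite inE; first exact: measurable_rat_box.
  exact: open_measurable_rV.
rewrite (leb_itv_box (fun i => ratr (c.1 ord0 i)) (fun i => ratr (c.2 ord0 i))).
elim/big_ind : _ => // [a b a0 b0|i _]; first exact: mule_gt0.
have /andP[h1 h2] := cv i.
by rewrite (lt_trans h1 h2) lte_fin subr_gt0 (lt_trans h1 h2).
Qed.

Variable nu : E -> R.

(** The complement of the support is covered by the rational boxes on which nu
vanishes almost everywhere, and there are countably many of them. *)
Lemma ae_off_supp : {ae leb d, forall h, ~ supp nu h -> nu h = 0}.
Proof.
have good n : {ae leb d, forall h, ({ae leb d, forall h', box_system n h' -> nu h' = 0}) ->
    box_system n h -> nu h = 0}.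
  have [g|ng] := pselect ({ae leb d, forall h', box_system n h' -> nu h' = 0}).
    by apply: filterS g => h H _.
  by apply: nearW => h /ng.
apply: filterS (ae_foralln good) => h H; rewrite /supp /= => /contrapT[U [oU U0] Uh].
have [c ch cU] := rat_box_nbhs oU Uh.
apply: (H (pickle (Some c))); rewrite box_systemE//.
by apply: filterS U0 => y Hy cy; apply/Hy/cU.
Qed.

Lemma open_Omega_nu (Omega : set E) : open Omega -> open (Omega_nu Omega nu).
Proof.
move=> oO.
rewrite (_ : Omega_nu Omega nu = \bigcup_(h in supp nu) ((fun x : E => x - h) @^-1` Omega)).
  apply: bigcup_open => h _.
  have c : continuous (fun x : E => x - h).
    move=> x A /nbhs_ballP[e /= e0 eA]; apply/nbhs_ballP; exists e => // y [_ xy].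
    apply: eA; split => // i j; have := xy i j; rewrite /ball /= !mxE.
    by rewrite opprD opprK addrACA addNr addr0.
  by move/continuousP : c; exact.
apply/seteqP; split => [x [y Oy [h sh <-]]|x [h sh Oxh]].
  by exists h => //=; rewrite addrK.
by exists (x - h) => //; exists h => //; rewrite subrK.
Qed.

End lebesgue_reflection.

(** * The spaces of the statement *)

Section W_space_of_modular.
Context {R : realType} (d : nat) (p : R) (p1 : 1 < p).
Notation E := 'rV[R]_d.
Variables (Omega : set E) (nu : E -> R).
Local Notation star := (Omega_nu_star Omega nu).
Local Notation D := (Omega_nu Omega nu).
Hypothesis mstar : measurable star.
Variable M : power_modular p (leb d) star.
Hypothesis ME : forall u, measurable_fun star u ->
  M u = (Lp_pow Omega p u + seminorm_pow Omega D nu p u)%E.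
Hypothesis Lp_ge0 : forall u, (0 <= Lp_pow Omega p u)%E.
Hypothesis semi_ge0 : forall u, (0 <= seminorm_pow Omega D nu p u)%E.
Hypothesis semiT : forall u, measurable_fun setT u ->
  seminorm_pow Omega setT nu p u = seminorm_pow Omega D nu p u.

Lemma W_Omega_nuE u : W_Omega_nu Omega nu p u <-> modular_dom M u.
Proof.
split.
  by move=> [mu_ L S]; split => //; rewrite ME// lte_add_pinfty.
move=> [mu_]; rewrite ME// => LS; split => //.
  by apply: le_lt_trans LS; rewrite leeDl.
by apply: le_lt_trans LS; rewrite leeDr.
Qed.

Lemma W_normE u : modular_dom M u ->
  W_norm Omega D nu p u = (modular_norm M u)%:E.
Proof.
move=> Wu; rewrite /W_norm -ME; last by case: Wu.
by rewrite (modular_fin Wu) poweR_EFin.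
Qed.

Lemma W_RdE u : W_Rd Omega nu p u <-> measurable_fun setT u /\ modular_dom M u.
Proof.
split.
  move=> [mu_ L S]; split; first exact: mu_.
  apply/W_Omega_nuE; split; [exact: measurable_funTS|exact: L|].
  by rewrite -semiT; [exact: S|exact: mu_].
move=> [mu_ /W_Omega_nuE[_ L S]]; split; [exact: mu_|exact: L|].
by rewrite semiT; [exact: S|exact: mu_].
Qed.

Lemma W_dom_patch u : modular_dom M u ->
  W_Rd Omega nu p (patch (cst 0) star u) /\
  {ae leb d, forall x, star x -> patch (cst 0) star u x = u x}.
Proof.
move=> Wu; have e x : star x -> patch (cst 0) star u x = u x.
  by move=> sx; rewrite patchE mem_set.
have ae : {ae leb d, forall x, star x -> patch (cst 0) star u x = u x}.
  exact: nearW.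
split => //; have mu_ : measurable_fun star u by case: Wu.
have mp : measurable_fun setT (patch (cst 0) star u).
  exact/(measurable_restrictT _ mstar).
apply/W_RdE; split => //; split; first exact: measurable_funTS.
case: Wu => _; apply: le_lt_trans; apply: (@pm_fatou _ _ _ _ _ _ M (fun=> u)) => //.
  exact: measurable_funTS.
by apply: filterS ae => x H sx; rewrite H//; exact: cvg_cst.
Qed.

(** Both spaces have the same quotient: they consist of functions of finite modular,
and patching by zero puts a measurable function on the whole space in each class. *)
Lemma W_space_of_modular : W_separable_reflexive_Banach Omega nu p.
Proof.
pose N := modular_seminorm p1 mstar M.
exists (seminorm_quotient N), (sn_class N); split.
- split.
  + move=> a u v /W_Omega_nuE Wu /W_Omega_nuE Wv; split.
      by apply/W_Omega_nuE; exact: modular_dom_lin.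
    exact: (sn_class_comb (N := N)).
  + move=> b; have [u Wu <-] := sn_class_surj b; exists u => //.
    exact/W_Omega_nuE.
  + move=> u v /W_Omega_nuE Wu /W_Omega_nuE Wv; exact: modular_class_eq.
  + move=> u /W_Omega_nuE Wu; rewrite W_normE//; congr EFin.
    exact: (sn_class_norm (N := N)).
- split.
  + move=> a u v /W_RdE[mu_ Wu] /W_RdE[mv Wv]; split.
      apply/W_RdE; split; last exact: modular_dom_lin.
      apply: measurable_funD => //.
      by apply: measurable_funM => //; exact: measurable_cst.
    exact: (sn_class_comb (N := N)).
  + move=> b; have [u Wu <-] := sn_class_surj b.
    have [Wp ae] := W_dom_patch Wu; exists (patch (cst 0) star u) => //.
    by apply/modular_class_eq => //; have /W_RdE[] := Wp.
  + move=> u v /W_RdE[_ Wu] /W_RdE[_ Wv]; exact: modular_class_eq.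
  + move=> u /W_RdE[mu_ Wu].
    rewrite /W_norm semiT// -/(W_norm _ _ _ _ _) W_normE//; congr EFin.
    exact: (sn_class_norm (N := N)).
- split; first by move=> u /W_RdE[_ Wu]; apply/W_Omega_nuE.
  by move=> u /W_Omega_nuE Wu; have [] := W_dom_patch Wu.
- apply: (@modular_quotient_separable _ p p1 _ _ _ _ mstar M (@box_system R d)).
  + exact: measurable_box_systemE.
  + exact: box_system_setI.
  + exact: box_systemT.
- exact: modular_quotient_reflexive.
Qed.

End W_space_of_modular.

Section Levy_kernel.
Context {R : realType} (d : nat) (p : R) (p1 : 1 < p).
Notation E := 'rV[R]_d.
Variables (Omega : set E) (Omega_open : open Omega) (nu : E -> R).
Hypotheses (nu_ge0 : forall h : E, h != 0 -> 0 <= nu h)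
  (nu_meas : measurable_fun (~` [set 0] : set E) nu)
  (nu_sym : forall h : E, h != 0 -> nu (- h) = nu h).
Local Notation D := (Omega_nu Omega nu).
Local Notation star := (Omega_nu_star Omega nu).

Let p0 : 0 < p. Proof. exact: lt_trans p1. Qed.

Let mOm : measurable Omega. Proof. exact: open_measurable_rV. Qed.

Let mD : measurable D. Proof. by apply: open_measurable_rV; exact: open_Omega_nu. Qed.

Let mstar : measurable star. Proof. exact: measurableU. Qed.

(** The value of nu at the origin is arbitrary, possibly negative; it is replaced by 0,
which leaves |u x - u y|^p nu (x - y) unchanged. *)
Definition nu_off0 : E -> R := patch (cst 0) (~` [set 0]) nu.

Lemma nu_off0E h : h != 0 -> nu_off0 h = nu h.
Proof. by move=> h0; rewrite /nu_off0 patchE mem_set//=; exact/eqP. Qed.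

Lemma nu_off0_0 : nu_off0 0 = 0.
Proof. by rewrite /nu_off0 patchE memNset//=; exact. Qed.

Lemma nu_off0_ge0 h : 0 <= nu_off0 h.
Proof. by have [->|h0] := eqVneq h 0; [rewrite nu_off0_0|rewrite nu_off0E// nu_ge0]. Qed.

Lemma nu_off0N h : nu_off0 (- h) = nu_off0 h.
Proof.
have [->|h0] := eqVneq h 0; first by rewrite oppr0.
by rewrite !nu_off0E ?oppr_eq0// nu_sym.
Qed.

Lemma measurable_set0_rV : measurable [set (0 : E)].
Proof.
rewrite (_ : [set 0] = \bigcap_(i in [set: 'I_d])
    ((fun v : E => v ord0 i : measurableTypeR R) @^-1` [set 0])).
  apply: fin_bigcap_measurable => //= i _.
  by rewrite -[X in measurable X]setTI; apply: measurable_rV_coord.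
apply/seteqP; split => [v -> i _ /=|v h]; first by rewrite mxE.
by apply/rowP => i; rewrite mxE; exact: h i I.
Qed.

Lemma measurable_nu_off0 : measurable_fun setT nu_off0.
Proof.
have mC : measurable (~` [set (0 : E)]) by apply: measurableC; exact: measurable_set0_rV.
exact: (measurable_restrictT nu mC).1.
Qed.

Definition jump_kernel (z : E * E) : R := nu_off0 (z.1 - z.2).

Lemma jump_kernel_ge0 z : 0 <= jump_kernel z. Proof. exact: nu_off0_ge0. Qed.

Lemma measurable_jump_kernel : measurable_fun setT jump_kernel.
Proof. exact: (measurableT_comp measurable_nu_off0 (@measurable_rV_sub R d)). Qed.

Lemma seminorm_integrandE (u : E -> R) x y :
  `|u x - u y| `^ p * nu (x - y) = `|u x - u y| `^ p * jump_kernel (x, y).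
Proof.
rewrite /jump_kernel /=; have [->|xy] := eqVneq x y.
  by rewrite !subrr normr0 powR0 ?gt_eqF// !mul0r.
by rewrite nu_off0E// subr_eq0.
Qed.

Lemma energy_W u : measurable_fun star u ->
  energy p (leb d) Omega D jump_kernel u =
  (Lp_pow Omega p u + seminorm_pow Omega D nu p u)%E.
Proof.
move=> mu_; rewrite /energy; congr (_ + _)%E.
  by apply: eq_integral => x _; rewrite /= mulr1.
have mdiff : measurable_fun (Omega `*` D) (fun z => u z.1 - u z.2).
  apply: measurable_funB.
    apply: (@measurable_comp _ _ _ _ _ _ star u _ fst) => //.
      by move=> _ [z [h _] <-]; left.
    exact: measurable_funTS measurable_fst.
  apply: (@measurable_comp _ _ _ _ _ _ star u _ snd) => //.
    by move=> _ [z [_ h] <-]; right.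
  exact: measurable_funTS measurable_snd.
rewrite /power_integral (integral_prod_iterated (leb d) (leb d) mOm mD _ _).1.
- apply: eq_integral => x _; apply: eq_integral => y _.
  by rewrite seminorm_integrandE.
- apply: measurable_power => //; apply: measurable_funTS; exact: measurable_jump_kernel.
- by move=> z _; rewrite lee_fin mulr_ge0 ?powR_ge0// jump_kernel_ge0.
Qed.

Lemma ae_nu_off0_off_supp : {ae leb d, forall h, ~ supp nu h -> nu_off0 h = 0}.
Proof.
apply: filterS (ae_off_supp nu) => h H /H nh.
by have [->|h0] := eqVneq h 0; [exact: nu_off0_0|rewrite nu_off0E].
Qed.

(** For x in Omega and y outside Omega_nu, y - x is off the support, where nu
vanishes almost everywhere. *)
Lemma seminorm_pow_setT u : measurable_fun setT u ->
  seminorm_pow Omega setT nu p u = seminorm_pow Omega D nu p u.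
Proof.
move=> mu_; apply: eq_integral => x /set_mem Ox.
rewrite [RHS]integral_mkcond.
pose f y := (`|u x - u y| `^ p * jump_kernel (x, y))%:E.
have fE : (fun y => (`|u x - u y| `^ p * nu (x - y))%:E) = f.
  by apply/funext => y; rewrite seminorm_integrandE.
rewrite fE.
have mf : measurable_fun setT f.
  apply/measurable_EFinP; apply: measurable_funM.
    apply: (measurableT_comp (measurable_powR _)); apply: measurableT_comp => //.
    by apply: measurable_funB => //; exact: measurable_cst.
  exact: (measurableT_comp measurable_jump_kernel (measurable_pair1 x)).
have f0 y : (0 <= f y)%E by rewrite lee_fin mulr_ge0 ?powR_ge0// jump_kernel_ge0.
apply: ge0_ae_eq_integral => //.
- exact/(measurable_restrictT _ _).1/measurable_funTS.
- by move=> y _; exact: f0.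
- by move=> y _; rewrite patchE; case: ifP => // _; exact: f0.
(* reflecting twice gives the translation y |-> y - x *)
have H := ae_reflection x (ae_reflection 0 ae_nu_off0_off_supp).
apply: filterS H => y; rewrite sub0r opprB => H _.
rewrite patchE; case: ifPn => // /negP nD.
rewrite /f /jump_kernel /= -nu_off0N opprB H ?mulr0// => sxy; apply: nD; apply: mem_set.
by exists x => //; exists (y - x) => //; rewrite subrKC.
Qed.

Lemma omegaE y : ~ Omega y ->
  interaction_weight (leb d) Omega jump_kernel y = omega Omega nu y.
Proof.
move=> nOy; apply: eq_integral => x /set_mem Ox.
have xy : x - y != 0 by rewrite subr_eq0; apply/eqP => xy; apply: nOy; rewrite -xy.
by rewrite /jump_kernel /= nu_off0E// -(nu_sym xy) opprB.
Qed.

Theorem W_space_of_omega_gt0 :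
  {ae leb d, forall x, (D `\` Omega) x -> (0 < omega Omega nu x)%E} ->
  W_separable_reflexive_Banach Omega nu p.
Proof.
move=> w0.
have w : {ae leb d, forall y, (D `\` Omega) y ->
    (0 < interaction_weight (leb d) Omega jump_kernel y)%E}.
  by apply: filterS w0 => y H Dy; rewrite omegaE; [exact: H|case: Dy].
apply: (@W_space_of_modular R d p p1 Omega nu mstar
  (energy_modular p1 mOm mD jump_kernel_ge0 measurable_jump_kernel w)).
- exact: energy_W.
- by move=> u; apply: integral_ge0 => x _; rewrite lee_fin powR_ge0.
- move=> u; apply: integral_ge0 => x _; apply: integral_ge0 => y _.
  by rewrite seminorm_integrandE lee_fin mulr_ge0 ?powR_ge0// jump_kernel_ge0.
- exact: seminorm_pow_setT.
Qed.

(** If omega x were 0, nu (x - y) would vanish for almost every y in Omega, a set of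
positive measure since it is open and not empty. *)
Lemma full_support_omega_gt0 : {ae leb d, forall h, 0 < nu h} ->
  {ae leb d, forall x, (D `\` Omega) x -> (0 < omega Omega nu x)%E}.
Proof.
move=> nu_pos; apply: nearW => x [[z Oz _] nOx].
have Ogt0 : (0 < leb d Omega)%E by apply: leb_open_gt0 => //; exists z.
have xy y : Omega y -> x - y != 0.
  by move=> Oy; rewrite subr_eq0; apply/eqP => xy; apply: nOx; rewrite xy.
rewrite lt_neqAle; apply/andP; split; last first.
  by apply: integral_ge0 => y Oy; rewrite lee_fin le_min ler01 nu_ge0// xy.
apply/eqP => om0.
have mg : measurable_fun Omega (fun y => (Num.min 1 (nu_off0 (x - y)))%:E).
  apply/measurable_EFinP; apply: measurable_funTS; apply: measurable_minr => //.
  exact: (measurableT_comp measurable_nu_off0 (@measurable_reflection R d x)).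
have int0 : (\int[leb d]_(y in Omega) `|(Num.min 1%R (nu_off0 (x - y)))%:E| = 0)%E.
  rewrite [RHS]om0; apply: eq_integral => y /set_mem Oy.
  by rewrite nu_off0E ?xy// gee0_abs// lee_fin le_min ler01 nu_ge0// xy.
have aez := (ae_eq_integral_abs (leb d) mOm mg).1 int0.
have [N [mN N0 sN]] : {ae leb d, forall y, ~ Omega y}.
  have H := ae_reflection x nu_pos.
  apply: filterS2 aez H => y z1 z2 Oy; have := z1 Oy.
  rewrite nu_off0E ?xy// => -[] /eqP; apply/negP; rewrite gt_eqF//.
  by rewrite lt_min ltr01.
have : (leb d Omega <= leb d N)%E.
  by apply: le_measure; rewrite ?inE// => y Oy; apply: sN => /=; exact.
by rewrite N0 leNgt Ogt0.
Qed.

End Levy_kernel.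

Theorem theorem3p9 (R : realType) (d : nat) (d_ge1 : (1 <= d)%N)
    (Omega : set 'rV[R]_d) (Omega_open : open Omega)
    (p : R) (p_gt1 : 1 < p)
    (nu : 'rV[R]_d -> R)
    (nu_ge0 : forall h : 'rV[R]_d, h != 0 -> 0 <= nu h)
    (nu_meas : measurable_fun (~` [set 0] : set 'rV[R]_d) nu)
    (nu_sym : forall h : 'rV[R]_d, h != 0 -> nu (- h) = nu h)
    (nu_int : (\int[leb d]_(h in (~` [set 0%R] : set 'rV[R]_d))
                 (Num.min 1 (euclidean_norm h `^ p) * nu h)%:E < +oo)%E) :
  ({ae leb d, forall x, (Omega_nu Omega nu `\` Omega) x ->
                        (0 < omega Omega nu x)%E} ->
   W_separable_reflexive_Banach Omega nu p) /\
  ({ae leb d, forall h, 0 < nu h} ->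
   W_separable_reflexive_Banach Omega nu p).
Proof.
have main := W_space_of_omega_gt0 p_gt1 Omega_open nu_ge0 nu_meas nu_sym.
split; first exact: main.
move=> nu_pos; apply: main.
exact: full_support_omega_gt0.
Qed.
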